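(* Let $q=4$ and $\lambda=\frac{9996}{10000}$. There is a constant $C>0$ such that for every list-coloring instance $(G,L)$, $G=(V,E)$, satisfying $|L(u)|\ge\deg_G(u)+1$ for every $u\in V$, every vertex $v\in V$, every color $i\in[4]$ and every integer $D\ge3$, $$\bigl|P(G,L,v,i,D)-\Pr_{G,L}[c(v)=i]\bigr|\le C\cdot\lambda^{D-3}.$$
   Context: Colors are $[4]=\{1,2,3,4\}$ (so the condition $|L(u)|\ge\deg_G(u)+1$ forces maximum degree at most $3$). A list-coloring instance $(G,L)$ is a finite simple graph $G=(V,E)$ with $L:V\to 2^{[4]}$; a proper coloring is $c:V\to[4]$ with $c(u)\in L(u)$ for all $u$ and $c(u)\ne c(w)$ on every edge; $\Pr_{G,L}[c(v)=i]$ is the probability that $c(v)=i$ for $c$ uniform over proper colorings of $(G,L)$. For a vertex $v$, $G_v$ is $G$ with $v$ and its incident edges removed, and $G_{v,w}=(G_v)_w$. If $v$ has neighbors $v_1,\dots,v_d$ (in a fixed order), then for $k\in[d]$ and a color $j$, $L_{k,j}$ is the list assignment on $G_v$ with $L_{k,j}(v_\ell)=L(v_\ell)\setminus\{j\}$ for $\ell<k$ and $L_{k,j}(u)=L(u)$ for all other vertices $u$ (so $L_{1,j}=L$). The procedure $P(G,L,v,i,D)$ ($i\in[4]$, $D$ an integer) is defined recursively (empty products equal $1$): (a) If $i\notin L(v)$, return $0$. Otherwise, if $D\le 0$ or $\deg_G(v)=0$, return $1/|L(v)|$. (b) If $\deg_G(v)=1$ with neighbor $v_1$: let $x=P(G_v,L,v_1,i,D-1)$.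 If $|L(v)|=2$, say $L(v)=\{i,j\}$, let $y=P(G_v,L,v_1,j,D-1)$ and return $\frac{1-x}{2-x-y}$. If $|L(v)|=4$, return $\frac{1-x}{3}$. If $|L(v)|=3$, let $j$ be the unique color in $[4]\setminus L(v)$, $y=P(G_v,L,v_1,j,D-1)$, and return $\frac{1-x}{2+y}$. (c) If $\deg_G(v)=2$: order its neighbors $v_1,v_2$ so that $\deg_G(v_1)\ge\deg_G(v_2)$ and, if $\deg_G(v_1)=\deg_G(v_2)=1$, so that $i\notin L(v_1)$ implies $i\notin L(v_2)$. Let $u_1,\dots,u_{d_1}$ be the neighbors of $v_1$ in $G_v$ (fixed order) and for $k\in[d_1]$, $w\in[4]$ let $L'_{k,w}$ be the list assignment on $G_{v,v_1}$ with $L'_{k,w}(u_\ell)=L(u_\ell)\setminus\{w\}$ for $\ell<k$ and $L'_{k,w}(u)=L(u)$ otherwise. Set $x_{k,w}=P(G_{v,v_1},L'_{k,w},u_k,w,D-1)$ for $k\in[d_1]$, $w\in L(v_1)$. For $j\in L(v)$ set $f_j=0$ if $j\notin L(v_1)$ and otherwise $f_j=\frac{\prod_{k=1}^{d_1}(1-x_{k,j})}{\sum_{w\in L(v_1)}\prod_{k=1}^{d_1}(1-x_{k,w})}$, and set $y_j=P(G_v,L_{2,j},v_2,j,D-1)$. Return $\frac{(1-f_i)(1-y_i)}{\sum_{j\in L(v)}(1-f_j)(1-y_j)}$. (d) If $\deg_G(v)=3$ with neighbors $v_1,v_2,v_3$: for $j\in L(v)$ let $x_j=P(G_v,L_{1,j},v_1,j,D-1)$,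 $y_j=P(G_v,L_{2,j},v_2,j,D-1)$, $z_j=P(G_v,L_{3,j},v_3,j,D-1)$, and return $\frac{(1-x_i)(1-y_i)(1-z_i)}{\sum_{j\in L(v)}(1-x_j)(1-y_j)(1-z_j)}$. *)

(* Defs.v *)
From mathcomp Require Import all_boot all_order all_algebra.
Set Implicit Arguments. Unset Strict Implicit. Unset Printing Implicit Defensive.
Import Order.TTheory GRing.Theory Num.Theory.
Local Open Scope ring_scope.

(* Colors: 'I_4 = {0,1,2,3}, color k in 'I_4 stands for color k+1 of [4].
   A graph G = (V,E) is represented inside an ambient finite type T with a
   symmetric irreflexive edge relation e; the current vertex set is S : {set T}
   (so G_v is obtained by S :\ v, keeping e restricted to S).
   Lists: L : T -> {set 'I_4}.
   nb S v : the "fixed order" of the neighbours of v in the graph induced on S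
   (an arbitrary duplicate-free enumeration, see hypothesis nb_ok). *)

Section Defs.
Variable R : realFieldType.
Variable T : finType.
Variable e : rel T.
Variable nb : {set T} -> T -> seq T.

Definition nb_ok : Prop :=
  forall (S : {set T}) (v : T),
    uniq (nb S v) /\ forall w, (w \in nb S v) = (w \in S) && e v w.

Definition remove_on (s : seq T) (j : 'I_4) (L : T -> {set 'I_4}) : T -> {set 'I_4} :=
  fun u => if u \in s then L u :\ j else L u.

Definition inv_card (A : {set 'I_4}) : R := (#|A|%:R)^-1.

(* The procedure P(G,L,v,i,D), with G the graph induced by e on S.
   D is a natural number; D = 0 plays the role of D <= 0 (the theorem only
   uses D >= 3 and every recursive call decreases D by one). *)
Fixpoint P (D : nat) (S : {set T}) (L : T -> {set 'I_4}) (v : T) (i : 'I_4)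
  {struct D} : R :=
  if i \notin L v then 0 else
  match D with
  | 0%N => inv_card (L v)
  | D'.+1 =>
    let Sv := S :\ v in
    match nb S v with
    | [::] => inv_card (L v)
    | [:: v1] =>
        let x := P D' Sv L v1 i in
        if #|L v| == 2%N then
          let j := odflt i [pick j in L v :\ i] in
          let y := P D' Sv L v1 j in
          (1 - x) / (2 - x - y)
        else if #|L v| == 4%N then (1 - x) / 3
        else if #|L v| == 3%N then
          let j := odflt i [pick j | j \notin L v] in
          let y := P D' Sv L v1 j in
          (1 - x) / (2 + y)
        else inv_card (L v) (* unreachable under |L(u)| >= deg(u)+1 *)
    | [:: a; b] =>
        (* order v1, v2: deg_G(v1) >= deg_G(v2), and if both have degree 1,
           (i \notin L v1) -> (i \notin L v2) *)
        let da := size (nb S a) in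
        let db := size (nb S b) in
        let swap := (da < db)%N ||
                    [&& da == 1%N, db == 1%N, i \notin L a & i \in L b] in
        let v1 := if swap then b else a in
        let v2 := if swap then a else b in
        let us := nb Sv v1 in
        let Svv1 := Sv :\ v1 in
        let g (w : 'I_4) : R :=
          \prod_(k < size us)
             (1 - P D' Svv1 (remove_on (take k us) w L) (nth v us k) w) in
        let f (j : 'I_4) : R :=
          if j \in L v1 then g j / \sum_(w in L v1) g w else 0 in
        let y (j : 'I_4) : R := P D' Sv (remove_on [:: v1] j L) v2 j in
        (1 - f i) * (1 - y i) / \sum_(j in L v) (1 - f j) * (1 - y j)
    | [:: a; b; c] =>
        let t (j : 'I_4) : R :=
          (1 - P D' Sv (remove_on [::] j L) a j)
          * (1 - P D' Sv (remove_on [:: a] j L) b j)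
          * (1 - P D' Sv (remove_on [:: a; b] j L) c j) in
        t i / \sum_(j in L v) t j
    | _ => inv_card (L v) (* degree > 3: unreachable under the hypothesis *)
    end
  end.

Definition deg (u : T) : nat := #|[set w | e u w]|.

Definition proper_col (L : T -> {set 'I_4}) (c : {ffun T -> 'I_4}) : bool :=
  [forall u, c u \in L u] && [forall u, forall w, e u w ==> (c u != c w)].

Definition Prob (L : T -> {set 'I_4}) (v : T) (i : 'I_4) : R :=
  #|[set c | proper_col L c & c v == i]|%:R / #|[set c | proper_col L c]|%:R.

End Defs.

Definition lambda (R : realFieldType) : R := 9996%:R / 10000%:R.

(* Main.v *)
Require Import Defs.
From mathcomp Require Import all_boot all_order all_algebra.
From mathcomp Require Import ring lra.
Set Implicit Arguments. Unset Strict Implicit. Unset Printing Implicit Defensive.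
Import Order.TTheory GRing.Theory Num.Theory.
Local Open Scope ring_scope.

(**
  The exact marginals satisfy the recursion that defines [P], so both are obtained by applying
  the same maps to different values at the leaves of the recursion tree, and it is enough to
  show that one application contracts.  Below the root every queried vertex has
  [|L v| >= deg v + 2], which keeps all values in [0, 1/2].  Errors are measured in the
  metric [|dx| / Phi x] with [Phi x = x (kap - x)], where [kap] is slightly above [1/2]: two values
  are [eps]-close if a path in [0, 1/2] with [|X'| <= eps * Phi X] joins them.  The image of such
  a family of paths under the recursion is again a path, so only a pointwise derivative estimate
  is needed.

  At a vertex of degree 2, write [f] for the law of the first neighbour (itself expanded one
  level), [y] for the second one, [b = 1 - f] and [c = 1 - y].  As the [f_j] sum to 1, their
  derivatives partly cancel; what remains is an inequality ([balance <= 0]) that is affine in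
  [f], so it is checked at the corners of the range of [f], where it is a sum of concave
  quadratics in the [c_j].

  The mean value theorem needs real numbers.  Over an arbitrary ordered field all the quantities
  involved are images of rational numbers.
*)

(** * The inequality behind the contraction *)

Section Ineq.
Variable R : realFieldType.
Implicit Types (w u c f x y : R).

(* [kap = 1/2] would make [Phi] vanish at the attainable value [1/2]; [psimax] is a rational upper
   bound of [(1 - sqrt (1 - kap)) ^ 2], the maximum of [Phi x / (1 - x)]. *)
Definition kap : R := 507 / 1000.
Definition rate : R := 199 / 200.
Definition psimax : R := 111 / 1250.
Definition Phi x : R := x * (kap - x).

(** Maximum of a concave quadratic, by completing the square. The reciprocal [v] of [4 * w] is a
    separate parameter, so that no division occurs. *)
Lemma quadratic_le w v u c :
  0 < w -> 4 * w * v = 1 -> - (w * c ^+ 2) + u * c <= u ^+ 2 * v.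
Proof.
move=> w0 wv; have v0 : 0 < v by rewrite -(pmulr_rgt0 v (_ : 0 < 4 * w)) ?wv ?mulr_gt0.
have -> : - (w * c ^+ 2) + u * c = - (w * (4 * w * v) * c ^+ 2) + u * (4 * w * v) * c.
  by rewrite wv !mulr1.
rewrite -subr_ge0.
have -> : u ^+ 2 * v - (- (w * (4 * w * v) * c ^+ 2) + u * (4 * w * v) * c)
  = v * (u - 2 * w * c) ^+ 2 by ring.
by rewrite mulr_ge0 ?sqr_ge0 ?ltW.
Qed.

(* [psi] is bounded by the constant [psimax] for [c0 <= h] and by a tangent line for [c0 >= h]. *)
Lemma corner_bound w1 w2 w3 v1 v2 v3 u1 u2 u3 e K A B h c0 psi c1 c2 c3 :
  0 < w1 -> 0 < w2 -> 0 < w3 -> 4 * w1 * v1 = 1 -> 4 * w2 * v2 = 1 -> 4 * w3 * v3 = 1 ->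
  0 <= c1 -> 0 <= c2 -> 0 <= c3 -> 0 <= e ->
  psi <= psimax -> psi <= A - B * c0 -> c0 <= 1 -> h < 1 -> A - B * h <= psimax ->
  (w1 * psimax + u1) ^+ 2 * v1 + (w2 * psimax + u2) ^+ 2 * v2
    + (w3 * psimax + u3) ^+ 2 * v3 + K + e * h <= 0 ->
  (w1 * (A - B) + u1) ^+ 2 * v1 + (w2 * (A - B) + u2) ^+ 2 * v2
    + (w3 * (A - B) + u3) ^+ 2 * v3 + K + e <= 0 ->
  (- (w1 * c1 ^+ 2) + (w1 * psi + u1) * c1) + (- (w2 * c2 ^+ 2) + (w2 * psi + u2) * c2)
    + (- (w3 * c3 ^+ 2) + (w3 * psi + u3) * c3) + K + e * c0 <= 0.
Proof.
move=> w1_gt0 w2_gt0 w3_gt0 wv1 wv2 wv3 c1_ge0 c2_ge0 c3_ge0 e_ge0 le_max le_line c0_le1 h_lt1 line_h.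
set Q := w1 * c1 + w2 * c2 + w3 * c3.
have Q_ge0 : 0 <= Q.
  by apply: addr_ge0; [apply: addr_ge0|]; apply: mulr_ge0 => //; exact: ltW.
pose G p c := (- (w1 * c1 ^+ 2) + (w1 * p + u1) * c1) + (- (w2 * c2 ^+ 2) + (w2 * p + u2) * c2)
    + (- (w3 * c3 ^+ 2) + (w3 * p + u3) * c3) + K + e * c.
move=> at_h at_1.
have Gh : G psimax h <= 0.
  apply: le_trans at_h; rewrite /G !lerD2r.
  by apply: lerD; [apply: lerD|]; exact: quadratic_le.
have G1 : G (A - B) 1 <= 0.
  apply: le_trans at_1; rewrite /G mulr1 !lerD2r.
  by apply: lerD; [apply: lerD|]; exact: quadratic_le.
have GE p c : G p c = G 0 0 + p * Q + e * c by rewrite /G /Q; ring.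
rewrite -[leLHS]/(G psi c0) GE.
rewrite GE in Gh; rewrite GE in G1.
case: (leP c0 h) => hc.
  by apply: le_trans Gh; rewrite lerD ?ler_wpM2l// lerD2l ler_wpM2r.
(* Along the line both [psi * Q] and [e * c0] are affine in [c0]. *)
have Hh : G 0 0 + (A - B * h) * Q + e * h <= 0.
  by apply: le_trans Gh; rewrite lerD2r lerD2l ler_wpM2r.
have Hc : G 0 0 + psi * Q + e * c0 <= G 0 0 + (A - B * c0) * Q + e * c0.
  by rewrite lerD2r lerD2l ler_wpM2r.
apply: (le_trans Hc).
have h1 : 0 < 1 - h by rewrite subr_gt0.
rewrite -(pmulr_rle0 _ h1).
have -> : (1 - h) * (G 0 0 + (A - B * c0) * Q + e * c0)
  = (1 - c0) * (G 0 0 + (A - B * h) * Q + e * h)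
    + (c0 - h) * (G 0 0 + (A - B) * Q + e * 1) by ring.
rewrite -[leRHS]addr0 lerD// mulr_ge0_le0 ?subr_ge0//; exact: ltW.
Qed.

(* With [c0 * psi = Phi (1 - c0)], [r] the spread of [c1, c2, c3] and [th * eps] a bound on the
   logarithmic derivatives of the inner products, [balance] is the bound on [|p'| * Z ^ 2] minus
   [rate * eps * Phi p * Z ^ 2], divided by [eps * (1 - f) * c0]. *)
Definition balance (th f f1 f2 f3 c0 psi c1 c2 c3 r : R) : R :=
  (1 - f1) * (psi * c1 + (1 - c1) * (c1 - (1 - kap)) - rate * kap * c1)
  + (1 - f2) * (psi * c2 + (1 - c2) * (c2 - (1 - kap)) - rate * kap * c2)
  + (1 - f3) * (psi * c3 + (1 - c3) * (c3 - (1 - kap)) - rate * kap * c3)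
  + th * (2 * f * (c1 + c2 + c3) + (1 - f) * r / 2)
  + rate * (1 - kap) * (1 - f) * c0.

(* The signs for which [s1 * c1 + s2 * c2 + s3 * c3] is a difference of two of the [c_j]. *)
Definition pattern (s1 s2 s3 : R) : Prop :=
  (s1 = 1 /\ s2 = -1 /\ s3 = 0) \/ (s1 = -1 /\ s2 = 1 /\ s3 = 0)
  \/ (s1 = 1 /\ s2 = 0 /\ s3 = -1) \/ (s1 = -1 /\ s2 = 0 /\ s3 = 1)
  \/ (s1 = 0 /\ s2 = 1 /\ s3 = -1) \/ (s1 = 0 /\ s2 = -1 /\ s3 = 1).

(** After multiplication by [c0], a quadratic in [c0] with leading coefficient [1 - B] has to be
    nonnegative; the last hypothesis says that its discriminant is at most 0. *)
Lemma psi_tangent A B c0 psi :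
  1/2 <= c0 -> c0 * psi = (1 - c0) * (c0 - (1 - kap)) -> B < 1 ->
  (1493/1000 - A) ^+ 2 <= 4 * (1 - B) * (493/1000) -> psi <= A - B * c0.
Proof.
rewrite /kap => hc Hp HB HD.
have c_gt0 : 0 < c0 by lra.
rewrite -(ler_pM2l c_gt0) Hp -subr_ge0 -(pmulr_rge0 _ (_ : 0 < 4 * (1 - B))); last by lra.
have -> : 4 * (1 - B) * (c0 * (A - B * c0) - (1 - c0) * (c0 - (1 - 507 / 1000)))
 = (2 * (1 - B) * c0 - (1493/1000 - A)) ^+ 2 +
   (4 * (1 - B) * (493/1000) - (1493/1000 - A) ^+ 2) by field.
by rewrite addr_ge0 ?sqr_ge0 ?subr_ge0.
Qed.

(** The horizontal line, [B = 0]. *)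
Lemma psi_le_max c0 psi : 1/2 <= c0 -> c0 * psi = (1 - c0) * (c0 - (1 - kap)) -> psi <= psimax.
Proof.
move=> hc Hp; rewrite -[psimax](subr0) -(mul0r c0).
by apply: (psi_tangent hc Hp); rewrite /psimax; lra.
Qed.

Section Corner.
Variables (c0 psi c1 c2 c3 s1 s2 s3 : R).
Hypotheses (hs : pattern s1 s2 s3) (hpsi : c0 * psi = (1 - c0) * (c0 - (1 - kap))).
Hypotheses (h0 : 1/2 <= c0 <= 1) (h1 : 0 <= c1) (h2 : 0 <= c2) (h3 : 0 <= c3).
Let r := s1 * c1 + s2 * c2 + s3 * c3.

Ltac split_pattern :=
  case: hs => [[-> [-> ->]]|[[-> [-> ->]]|[[-> [-> ->]]|[[-> [-> ->]]|[[-> [-> ->]]|[-> [-> ->]]]]]]].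

(** Since [r] is linear in the [c_j], the expression splits into one quadratic per [c_j], the shape
    that [corner_bound] requires. *)
Let cornerE th f f1 f2 f3 :
  balance th f f1 f2 f3 c0 psi c1 c2 c3 r =
  (- ((1 - f1) * c1 ^+ 2) + ((1 - f1) * psi + ((1 - f1) * (2 - kap - rate * kap)
       + th * (2 * f + (1 - f) * s1 / 2))) * c1)
  + (- ((1 - f2) * c2 ^+ 2) + ((1 - f2) * psi + ((1 - f2) * (2 - kap - rate * kap)
       + th * (2 * f + (1 - f) * s2 / 2))) * c2)
  + (- ((1 - f3) * c3 ^+ 2) + ((1 - f3) * psi + ((1 - f3) * (2 - kap - rate * kap)
       + th * (2 * f + (1 - f) * s3 / 2))) * c3)
  + - ((3 - f1 - f2 - f3) * (1 - kap)) + rate * (1 - kap) * (1 - f) * c0.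
Proof. by rewrite /balance /r; field. Qed.

(** With [corner_two_high], the two ends of the segment on which [f1] and [f2] sit at their minimum
    [1/13] and [f] runs from [1/13] to [4/7]. *)
Lemma corner_two_low : balance (2 * psimax) (1/13) (1/13) (1/13) (10/13) c0 psi c1 c2 c3 r <= 0.
Proof.
have [h01 h02] := andP h0.
have Hm := psi_le_max h01 hpsi.
(* A line slightly above a tangent of [psi]. At [h] below it has come down to [psimax], and each
   [v_j] is the reciprocal of [4 * (1 - f_j)]. The other corners follow the same scheme. *)
have Ht : psi <= 203/500 - 2/5 * c0 by apply: (psi_tangent h01 hpsi); lra.
rewrite cornerE.
apply: (corner_bound (h := 793/1000) (v1 := 13/48) (v2 := 13/48) (v3 := 13/12)
   _ _ _ _ _ _ h1 h2 h3 _ Hm Ht h02);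
  rewrite /psimax /kap /rate; [lra.. | split_pattern; lra | split_pattern; lra].
Qed.

Lemma corner_two_high : balance (2 * psimax) (4/7) (1/13) (1/13) (25/91) c0 psi c1 c2 c3 r <= 0.
Proof.
have [h01 h02] := andP h0.
have Hm := psi_le_max h01 hpsi.
have Ht : psi <= 199/1000 - 3/20 * c0 by apply: (psi_tangent h01 hpsi); lra.
rewrite cornerE.
apply: (corner_bound (h := 147/200) (v1 := 13/48) (v2 := 13/48) (v3 := 91/264)
   _ _ _ _ _ _ h1 h2 h3 _ Hm Ht h02);
  rewrite /psimax /kap /rate; [lra.. | split_pattern; lra | split_pattern; lra].
Qed.

(** With [corner_one_high], the two ends of the segment on which [f1] and [f2] sit at their maximum
    [1/2] and [f] runs from 0 to [1/2]. *)
Lemma corner_one_low : balance psimax 0 (1/2) (1/2) 0 c0 psi c1 c2 c3 r <= 0.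
Proof.
have [h01 h02] := andP h0.
have Hm := psi_le_max h01 hpsi.
have Ht : psi <= 481/1000 - 12/25 * c0 by apply: (psi_tangent h01 hpsi); lra.
rewrite cornerE.
apply: (corner_bound (h := 409/500) (v1 := 1/2) (v2 := 1/2) (v3 := 1/4)
   _ _ _ _ _ _ h1 h2 h3 _ Hm Ht h02);
  rewrite /psimax /kap /rate; [lra.. | split_pattern; lra | split_pattern; lra].
Qed.

(* The value [-1/2] is outside the range of [f3]: only the upper bounds on [f1, f2] are used. *)
Lemma corner_one_high : balance psimax (1/2) (1/2) (1/2) (-1/2) c0 psi c1 c2 c3 r <= 0.
Proof.
have [h01 h02] := andP h0.
have Hm := psi_le_max h01 hpsi.
have Ht : psi <= 107/500 - 17/100 * c0 by apply: (psi_tangent h01 hpsi); lra.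
rewrite cornerE.
apply: (corner_bound (h := 737/1000) (v1 := 1/2) (v2 := 1/2) (v3 := 1/6)
   _ _ _ _ _ _ h1 h2 h3 _ Hm Ht h02);
  rewrite /psimax /kap /rate; [lra.. | split_pattern; lra | split_pattern; lra].
Qed.

End Corner.
End Ineq.

(** * Reduction of the balance inequality to the corners *)

Section Balance.
Variable R : realFieldType.
Implicit Types (th a b c f r x y : R).

Lemma affine_le0 (u v a b x : R) :
  a < b -> u + v * a <= 0 -> u + v * b <= 0 -> a <= x <= b -> u + v * x <= 0.
Proof.
move=> ab ua ub /andP[ax xb].
have ba : 0 < b - a by rewrite subr_gt0.
rewrite -(pmulr_rle0 _ ba).
have -> : (b - a) * (u + v * x) = (b - x) * (u + v * a) + (x - a) * (u + v * b) by ring.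
by rewrite -[leRHS]addr0 lerD// mulr_ge0_le0 ?subr_ge0.
Qed.

Lemma ler_of_eq (x y : R) : x = y -> x <= y.
Proof. by move->. Qed.

(** The coefficient of [1 - f_j] in [balance]: moving mass from one [f_j] to another changes
    [balance] by a difference of slopes. *)
Definition slope (psi c : R) : R :=
  psi * c + (1 - c) * (c - (1 - kap R)) - rate R * kap R * c.

Lemma balanceE th f f1 f2 f3 c0 psi c1 c2 c3 r :
  balance th f f1 f2 f3 c0 psi c1 c2 c3 r =
  (1 - f1) * slope psi c1 + (1 - f2) * slope psi c2 + (1 - f3) * slope psi c3
  + th * (2 * f * (c1 + c2 + c3) + (1 - f) * r / 2) + rate R * (1 - kap R) * (1 - f) * c0.
Proof. by []. Qed.

Section CornerReduction.
Variables (c0 psi : R).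
Hypotheses (hpsi : c0 * psi = (1 - c0) * (c0 - (1 - kap R))) (h0 : 1/2 <= c0 <= 1).

Let admissible c1 c2 c3 s1 s2 s3 :=
  [/\ 0 <= c1, 0 <= c2, 0 <= c3 & @pattern R s1 s2 s3].

Let bal th f f1 f2 f3 c1 c2 c3 s1 s2 s3 :=
  balance th f f1 f2 f3 c0 psi c1 c2 c3 (s1 * c1 + s2 * c2 + s3 * c3).

Let bal_mono th f f1 f2 f3 g1 g2 g3 c1 c2 c3 s1 s2 s3 :
  f1 + f2 + f3 = g1 + g2 + g3 ->
  (f1 - g1) * (slope psi c3 - slope psi c1) + (f2 - g2) * (slope psi c3 - slope psi c2) <= 0 ->
  bal th f f1 f2 f3 c1 c2 c3 s1 s2 s3 <= bal th f g1 g2 g3 c1 c2 c3 s1 s2 s3.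
Proof.
move=> E H; rewrite -subr_le0; apply: le_trans H.
apply: ler_of_eq; rewrite /bal !balanceE.
have -> : f3 = g1 + g2 + g3 - f1 - f2 by rewrite -E; ring.
ring.
Qed.

(** The third slope is the smallest, so [balance] grows when mass moves to [f3] until [f1] and [f2]
    reach [1/13]. What is left is affine in [f]. *)
Let balance_two_corner f f1 f2 f3 c1 c2 c3 s1 s2 s3 :
  1/13 <= f <= 4/7 -> 1/13 <= f1 -> 1/13 <= f2 -> f + f1 + f2 + f3 = 1 ->
  slope psi c3 <= slope psi c1 -> slope psi c3 <= slope psi c2 ->
  admissible c1 c2 c3 s1 s2 s3 ->
  bal (2 * psimax R) f f1 f2 f3 c1 c2 c3 s1 s2 s3 <= 0.
Proof.
move=> hf hf1 hf2 fE le1 le2 [c1_ge0 c2_ge0 c3_ge0 hs].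
apply: (@le_trans _ _ (bal (2 * psimax R) f (1/13) (1/13) (11/13 - f) c1 c2 c3 s1 s2 s3)).
  apply: bal_mono; first by lra.
  by rewrite -[leRHS]addr0 lerD// mulr_ge0_le0 ?subr_ge0 ?subr_le0.
have A0 := corner_two_low hs hpsi h0 c1_ge0 c2_ge0 c3_ge0.
have A1 := corner_two_high hs hpsi h0 c1_ge0 c2_ge0 c3_ge0.
rewrite /bal balanceE.
set r := s1 * c1 + _ + _ in A0 A1 *; set th := 2 * _ in A0 A1 *.
pose u := (1 - 1/13) * slope psi c1 + (1 - 1/13) * slope psi c2 + (2/13) * slope psi c3
  + th * r / 2 + rate R * (1 - kap R) * c0.
pose v := slope psi c3 + th * (2 * (c1 + c2 + c3) - r / 2) - rate R * (1 - kap R) * c0.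
rewrite [leLHS](_ : _ = u + v * f); last by rewrite /u /v; field.
apply: (@affine_le0 u v (1/13) (4/7)) => //; first by lra.
- by apply: le_trans A0; apply: ler_of_eq; rewrite balanceE /u /v; field.
- by apply: le_trans A1; apply: ler_of_eq; rewrite balanceE /u /v; field.
Qed.

(** The third slope is the largest, so [balance] grows when mass moves from [f3] to [f1] and [f2]
    until both reach [1/2], which leaves [- f] for [f3]. *)
Let balance_one_corner f f1 f2 f3 c1 c2 c3 s1 s2 s3 :
  0 <= f <= 1/2 -> f1 <= 1/2 -> f2 <= 1/2 -> f + f1 + f2 + f3 = 1 ->
  slope psi c1 <= slope psi c3 -> slope psi c2 <= slope psi c3 ->
  admissible c1 c2 c3 s1 s2 s3 ->
  bal (psimax R) f f1 f2 f3 c1 c2 c3 s1 s2 s3 <= 0.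
Proof.
move=> hf hf1 hf2 fE le1 le2 [c1_ge0 c2_ge0 c3_ge0 hs].
apply: (@le_trans _ _ (bal (psimax R) f (1/2) (1/2) (- f) c1 c2 c3 s1 s2 s3)).
  apply: bal_mono; first by lra.
  by rewrite -[leRHS]addr0 lerD// mulr_le0_ge0 ?subr_ge0 ?subr_le0.
have B0 := corner_one_low hs hpsi h0 c1_ge0 c2_ge0 c3_ge0.
have B1 := corner_one_high hs hpsi h0 c1_ge0 c2_ge0 c3_ge0.
rewrite /bal balanceE.
set r := s1 * c1 + _ + _ in B0 B1 *; set th := psimax R in B0 B1 *.
pose u := (1 - 1/2) * slope psi c1 + (1 - 1/2) * slope psi c2 + slope psi c3
  + th * r / 2 + rate R * (1 - kap R) * c0.
pose v := slope psi c3 + th * (2 * (c1 + c2 + c3) - r / 2) - rate R * (1 - kap R) * c0.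
rewrite [leLHS](_ : _ = u + v * f); last by rewrite /u /v; field.
apply: (@affine_le0 u v 0 (1/2)) => //; first by lra.
- by apply: le_trans B0; apply: ler_of_eq; rewrite balanceE /u /v; field.
- by apply: le_trans B1; apply: ler_of_eq; rewrite balanceE /u /v; field.
Qed.

Let rotate th f f1 f2 f3 c1 c2 c3 s1 s2 s3 :
  bal th f f1 f2 f3 c1 c2 c3 s1 s2 s3 = bal th f f2 f3 f1 c2 c3 c1 s2 s3 s1.
Proof. rewrite /bal !balanceE [_ + s3 * c3]addrC addrA; ring. Qed.

Let admissible_rotate c1 c2 c3 s1 s2 s3 :
  admissible c1 c2 c3 s1 s2 s3 -> admissible c2 c3 c1 s2 s3 s1.
Proof.
case=> ? ? ? hs; split=> //; by move: hs; rewrite /pattern; tauto.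
Qed.

Lemma balance_le0_two f f1 f2 f3 c1 c2 c3 s1 s2 s3 :
  1/13 <= f <= 4/7 -> 1/13 <= f1 -> 1/13 <= f2 -> 1/13 <= f3 -> f + f1 + f2 + f3 = 1 ->
  0 <= c1 -> 0 <= c2 -> 0 <= c3 -> pattern s1 s2 s3 ->
  balance (2 * psimax R) f f1 f2 f3 c0 psi c1 c2 c3 (s1 * c1 + s2 * c2 + s3 * c3) <= 0.
Proof.
move=> hf hf1 hf2 hf3 fE p1 p2 p3 hs.
have adm : admissible c1 c2 c3 s1 s2 s3 by [].
(* A cyclic rotation brings the smallest slope to the third place. *)
have [le13|/ltW le31] := leP (slope psi c1) (slope psi c3);
  have [le12|/ltW le21] := leP (slope psi c1) (slope psi c2);
  have [le23|/ltW le32] := leP (slope psi c2) (slope psi c3).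
all: rewrite -/(bal _ _ _ _ _ _ _ _ _ _ _).
- by rewrite rotate; apply: balance_two_corner => //; [lra|exact: admissible_rotate].
- by rewrite rotate; apply: balance_two_corner => //; [lra|exact: admissible_rotate].
- by rewrite 2!rotate; apply: balance_two_corner => //; [lra|do 2!apply: admissible_rotate].
- by rewrite 2!rotate; apply: balance_two_corner => //; [lra|exact: le_trans le13|do 2!apply: admissible_rotate].
- by apply: balance_two_corner => //; exact: le_trans le12.
- by apply: balance_two_corner.
- by rewrite 2!rotate; apply: balance_two_corner => //; [lra|do 2!apply: admissible_rotate].
- by apply: balance_two_corner.
Qed.

Lemma balance_le0_one f f1 f2 f3 c1 c2 c3 s1 s2 s3 :
  0 <= f <= 1/2 -> f1 <= 1/2 -> f2 <= 1/2 -> f3 <= 1/2 -> f + f1 + f2 + f3 = 1 ->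
  0 <= c1 -> 0 <= c2 -> 0 <= c3 -> pattern s1 s2 s3 ->
  balance (psimax R) f f1 f2 f3 c0 psi c1 c2 c3 (s1 * c1 + s2 * c2 + s3 * c3) <= 0.
Proof.
move=> hf hf1 hf2 hf3 fE p1 p2 p3 hs.
have adm : admissible c1 c2 c3 s1 s2 s3 by [].
(* Here the largest slope is rotated to the third place. *)
have [le13|/ltW le31] := leP (slope psi c1) (slope psi c3);
  have [le12|/ltW le21] := leP (slope psi c1) (slope psi c2);
  have [le23|/ltW le32] := leP (slope psi c2) (slope psi c3).
all: rewrite -/(bal _ _ _ _ _ _ _ _ _ _ _).
- by apply: balance_one_corner.
- by rewrite 2!rotate; apply: balance_one_corner => //; [lra|do 2!apply: admissible_rotate].
- by apply: balance_one_corner.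
- by apply: balance_one_corner => //; exact: le_trans le13.
- by rewrite 2!rotate; apply: balance_one_corner => //; [lra|exact: le_trans le12|do 2!apply: admissible_rotate].
- by rewrite 2!rotate; apply: balance_one_corner => //; [lra|do 2!apply: admissible_rotate].
- by rewrite rotate; apply: balance_one_corner => //; [lra|exact: admissible_rotate].
- by rewrite rotate; apply: balance_one_corner => //; [lra|exact: admissible_rotate].
Qed.

End CornerReduction.
End Balance.

(** * Contraction at a vertex of degree two *)

Section Contraction.
Variable R : realFieldType.
Implicit Types (th f c q y d : R).

(** [m] is the midpoint of the two extreme values and [r] their difference; writing [r] as a signed
    combination keeps [balance] polynomial in the [c_j]. *)
Lemma range_pattern c1 c2 c3 : exists s1 s2 s3 m : R,
  let r := s1 * c1 + s2 * c2 + s3 * c3 in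
  [/\ pattern s1 s2 s3, `|c1 - m| <= r / 2, `|c2 - m| <= r / 2 & `|c3 - m| <= r / 2].
Proof.
rewrite /pattern.
have [le12|/ltW le21] := leP c1 c2; have [le23|/ltW le32] := leP c2 c3;
  have [le13|/ltW le31] := leP c1 c3.
1-2: exists (-1), 0, 1, ((c1 + c3) / 2).
3: exists (-1), 1, 0, ((c1 + c2) / 2).
4: exists 0, 1, (-1), ((c2 + c3) / 2).
5: exists 0, (-1), 1, ((c2 + c3) / 2).
6: exists 1, (-1), 0, ((c1 + c2) / 2).
7-8: exists 1, 0, (-1), ((c1 + c3) / 2).
all: by split; [tauto | rewrite ler_norml; apply/andP; split; lra ..].
Qed.

(* After rescaling, twice a covariance is at most the sum of the two variances. *)
Lemma covariance_le f1 f2 f3 c1 c2 c3 q1 q2 q3 m rho tau :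
  0 <= f1 -> 0 <= f2 -> 0 <= f3 ->
  `|c1 - m| <= rho -> `|c2 - m| <= rho -> `|c3 - m| <= rho ->
  `|q1| <= tau -> `|q2| <= tau -> `|q3| <= tau ->
  `|(f1 + f2 + f3) * (f1 * c1 * q1 + f2 * c2 * q2 + f3 * c3 * q3)
    - (f1 * c1 + f2 * c2 + f3 * c3) * (f1 * q1 + f2 * q2 + f3 * q3)|
  <= (f1 + f2 + f3) ^+ 2 * rho * tau.
Proof.
move=> f1_ge0 f2_ge0 f3_ge0.
(* A covariance does not change when the [c_j] are shifted by the constant [m]. *)
have -> : (f1 + f2 + f3) * (f1 * c1 * q1 + f2 * c2 * q2 + f3 * c3 * q3)
    - (f1 * c1 + f2 * c2 + f3 * c3) * (f1 * q1 + f2 * q2 + f3 * q3)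
  = (f1 + f2 + f3) * (f1 * (c1 - m) * q1 + f2 * (c2 - m) * q2 + f3 * (c3 - m) * q3)
    - (f1 * (c1 - m) + f2 * (c2 - m) + f3 * (c3 - m)) * (f1 * q1 + f2 * q2 + f3 * q3) by ring.
move: (c1 - m) (c2 - m) (c3 - m) => D1 D2 D3 hD1 hD2 hD3 hq1 hq2 hq3.
set X := _ - _.
have rho_ge0 : 0 <= rho by apply: le_trans hD1.
have tau_ge0 : 0 <= tau by apply: le_trans hq1.
(* The rescaling below multiplies by [rho * tau] and cancels it at the end, so the degenerate case
   comes first. *)
have [/eqP k0|k_neq0] := boolP (rho * tau == 0).
  rewrite -mulrA k0 mulr0 normr_le0; apply/eqP.
  have : (rho == 0) || (tau == 0) by rewrite -mulf_eq0 k0.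
  case/orP => [/eqP r0|/eqP t0].
    have D0 (D : R) : `|D| <= rho -> D = 0 by rewrite r0 normr_le0 => /eqP.
    by rewrite /X (D0 _ hD1) (D0 _ hD2) (D0 _ hD3); ring.
  have q0 (q : R) : `|q| <= tau -> q = 0 by rewrite t0 normr_le0 => /eqP.
  by rewrite /X (q0 _ hq1) (q0 _ hq2) (q0 _ hq3); ring.
have k_gt0 : 0 < rho * tau by rewrite lt0r k_neq0 mulr_ge0.
rewrite -(ler_pM2l k_gt0).
have sq (D : R) : `|D| <= rho -> tau ^+ 2 * D ^+ 2 <= (rho * tau) ^+ 2.
  move=> hD; rewrite exprMn mulrC ler_wpM2r ?sqr_ge0//.
  by rewrite -(real_normK (num_real D)) ler_sqr ?nnegrE.
have sq' (q : R) : `|q| <= tau -> rho ^+ 2 * q ^+ 2 <= (rho * tau) ^+ 2.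
  by move=> hq; rewrite exprMn ler_wpM2l ?sqr_ge0// -(real_normK (num_real q)) ler_sqr ?nnegrE.
have pq (a b : R) : 0 <= a -> 0 <= b -> forall x, 0 <= a * b * x ^+ 2.
  by move=> a_ge0 b_ge0 x; apply: mulr_ge0; [exact: mulr_ge0|exact: sqr_ge0].
set F := f1 + f2 + f3.
have F_ge0 : 0 <= F by apply: addr_ge0 => //; exact: addr_ge0.
(* [e] is a sign, so that one identity serves both sides of the absolute value. *)
have main (e : R) : e ^+ 2 = 1 -> rho * tau * (e * X) <= rho * tau * (F ^+ 2 * rho * tau).
  move=> e2.
  have h1 : 0 <= F * f1 * ((rho * tau) ^+ 2 - tau ^+ 2 * D1 ^+ 2 + ((rho * tau) ^+ 2 - rho ^+ 2 * q1 ^+ 2)).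
    by apply: mulr_ge0; [exact: mulr_ge0|apply: addr_ge0; rewrite subr_ge0; [exact: sq|exact: sq']].
  have h2 : 0 <= F * f2 * ((rho * tau) ^+ 2 - tau ^+ 2 * D2 ^+ 2 + ((rho * tau) ^+ 2 - rho ^+ 2 * q2 ^+ 2)).
    by apply: mulr_ge0; [exact: mulr_ge0|apply: addr_ge0; rewrite subr_ge0; [exact: sq|exact: sq']].
  have h3 : 0 <= F * f3 * ((rho * tau) ^+ 2 - tau ^+ 2 * D3 ^+ 2 + ((rho * tau) ^+ 2 - rho ^+ 2 * q3 ^+ 2)).
    by apply: mulr_ge0; [exact: mulr_ge0|apply: addr_ge0; rewrite subr_ge0; [exact: sq|exact: sq']].
  pose E D q := e * (tau * D) - rho * q.
  have h12 := pq _ _ f1_ge0 f2_ge0 (E D1 q1 - E D2 q2).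
  have h13 := pq _ _ f1_ge0 f3_ge0 (E D1 q1 - E D3 q3).
  have h23 := pq _ _ f2_ge0 f3_ge0 (E D2 q2 - E D3 q3).
  have h4 : 0 <= (f1 * (e * tau * D1) + f2 * (e * tau * D2) + f3 * (e * tau * D3)) ^+ 2 by exact: sqr_ge0.
  have h5 : 0 <= (f1 * (rho * q1) + f2 * (rho * q2) + f3 * (rho * q3)) ^+ 2 by exact: sqr_ge0.
  rewrite -subr_ge0 -(pmulr_rge0 _ (_ : 0 < 2)); last by lra.
  (* Twice the gap as a sum of nonnegative terms, plus a last one that vanishes because
     [e ^+ 2 = 1]. *)
  have -> : 2 * (rho * tau * (F ^+ 2 * rho * tau) - rho * tau * (e * X)) =
    F * f1 * ((rho * tau) ^+ 2 - tau ^+ 2 * D1 ^+ 2 + ((rho * tau) ^+ 2 - rho ^+ 2 * q1 ^+ 2))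
    + F * f2 * ((rho * tau) ^+ 2 - tau ^+ 2 * D2 ^+ 2 + ((rho * tau) ^+ 2 - rho ^+ 2 * q2 ^+ 2))
    + F * f3 * ((rho * tau) ^+ 2 - tau ^+ 2 * D3 ^+ 2 + ((rho * tau) ^+ 2 - rho ^+ 2 * q3 ^+ 2))
    + f1 * f2 * (E D1 q1 - E D2 q2) ^+ 2 + f1 * f3 * (E D1 q1 - E D3 q3) ^+ 2
    + f2 * f3 * (E D2 q2 - E D3 q3) ^+ 2
    + (f1 * (e * tau * D1) + f2 * (e * tau * D2) + f3 * (e * tau * D3)) ^+ 2
    + (f1 * (rho * q1) + f2 * (rho * q2) + f3 * (rho * q3)) ^+ 2
    + (1 - e ^+ 2) * F * (f1 * (tau * D1) ^+ 2 + f2 * (tau * D2) ^+ 2 + f3 * (tau * D3) ^+ 2).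
    by rewrite /E /X /F; ring.
  by rewrite e2 subrr !mul0r addr0; do !apply: addr_ge0.
rewrite ler_pM2l// ler_norml; apply/andP; split.
  rewrite lerNl -(ler_pM2l k_gt0) -mulN1r; apply: main; ring.
by rewrite -(ler_pM2l k_gt0) -[X]mul1r; apply: main; rewrite expr1n.
Qed.

(* The first alternative is for a first neighbour with at most one further neighbour, the second
   for one with two. *)
Definition regime (th f0 f1 f2 f3 : R) : Prop :=
  (th = psimax R /\ [/\ f0 <= 1/2, f1 <= 1/2, f2 <= 1/2 & f3 <= 1/2]) \/
  (th = 2 * psimax R /\ [/\ 1/13 <= f0 <= 4/7, 1/13 <= f1, 1/13 <= f2 & 1/13 <= f3]).

Lemma balance_le0 th f0 f1 f2 f3 c0 psi c1 c2 c3 s1 s2 s3 :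
  regime th f0 f1 f2 f3 -> 0 <= f0 -> f0 + f1 + f2 + f3 = 1 ->
  c0 * psi = (1 - c0) * (c0 - (1 - kap R)) -> 1/2 <= c0 <= 1 ->
  0 <= c1 -> 0 <= c2 -> 0 <= c3 -> pattern s1 s2 s3 ->
  balance th f0 f1 f2 f3 c0 psi c1 c2 c3 (s1 * c1 + s2 * c2 + s3 * c3) <= 0.
Proof.
move=> [[-> [hf0 hf1 hf2 hf3]]|[-> [hf0 hf1 hf2 hf3]]] f_ge0 fE hpsi h0 p1 p2 p3 hs.
  by apply: balance_le0_one => //; rewrite f_ge0.
exact: balance_le0_two.
Qed.

Lemma normrD_le (x y a b : R) : `|x| <= a -> `|y| <= b -> `|x + y| <= a + b.
Proof. by move=> xa yb; apply: le_trans (ler_normD _ _) (lerD xa yb). Qed.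

Lemma normrB_le (x y a b : R) : `|x| <= a -> `|y| <= b -> `|x - y| <= a + b.
Proof. by move=> xa yb; apply: normrD_le; rewrite ?normrN. Qed.

Lemma normrM_le (x y a : R) : 0 <= x -> `|y| <= a -> `|x * y| <= x * a.
Proof. by move=> x0 ya; rewrite normrM (ger0_norm x0) ler_wpM2l. Qed.

Lemma half_compl y : 0 <= y <= 1/2 -> 1/2 <= 1 - y <= 1.
Proof. by move=> /andP[? ?]; apply/andP; split; lra. Qed.

Lemma half_compl_ge0 y : 0 <= y <= 1/2 -> 0 <= 1 - y.
Proof. by move=> /andP[? ?]; lra. Qed.

Section TwoLayer.
Variables (th eps : R) (f0 f1 f2 f3 y0 y1 y2 y3 d0 d1 d2 d3 q0 q1 q2 q3 : R).

(** Along a path, [q_j] is the logarithmic derivative of the unnormalised weight behind [f_j], so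
    [f_j] has derivative [f_j * (q_j - qm)]; [d_j] is the derivative of [y_j]. Hence [da] and [dZ]
    are the derivatives of [a] and [Z]. *)
Let qm := f0 * q0 + f1 * q1 + f2 * q2 + f3 * q3.
Let a f y : R := (1 - f) * (1 - y).
Let da f y q d : R := - (f * (q - qm)) * (1 - y) - (1 - f) * d.
Let Z := a f0 y0 + a f1 y1 + a f2 y2 + a f3 y3.
Let dZ := da f0 y0 q0 d0 + da f1 y1 q1 d1 + da f2 y2 q2 d2 + da f3 y3 q3 d3.

(** The first weight is at most [1 - f0], while the other three sum to at least [(2 + f0) / 2]; this
    makes the new value at most [1/2]. The constant [3/14] is [(1 - 4/7) * (1/2)]. *)
Lemma two_layer_bounds :
  regime th f0 f1 f2 f3 -> 0 <= f0 -> 0 <= f1 -> 0 <= f2 -> 0 <= f3 ->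
  f0 + f1 + f2 + f3 = 1 ->
  0 <= y0 <= 1/2 -> 0 <= y1 <= 1/2 -> 0 <= y2 <= 1/2 -> 0 <= y3 <= 1/2 ->
  [/\ 0 < Z, 3/14 <= a f0 y0 & a f0 y0 <= Z / 2].
Proof.
move=> Hreg f0_ge0 f1_ge0 f2_ge0 f3_ge0 fE hy0 hy1 hy2 hy3.
have hf0 : f0 <= 4/7 by move: Hreg => [[_ [? _ _ _]]|[_ [/andP[? ?] _ _ _]]]; lra.
have [h0 h0'] := andP hy0; have [h1 h1'] := andP hy1; have [h2 h2'] := andP hy2; have [h3 h3'] := andP hy3.
have lo f y : 0 <= f -> f <= 1 -> 0 <= y -> y <= 1/2 -> (1 - f) / 2 <= a f y <= 1 - f.
  by move=> ? ? ? ?; rewrite /a; apply/andP; split; nra.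
have [g0 [g1 [g2 g3]]] : f0 <= 1 /\ f1 <= 1 /\ f2 <= 1 /\ f3 <= 1 by do !split; lra.
have /andP[l0 u0] := lo f0 y0 f0_ge0 g0 h0 h0'.
have /andP[l1 u1] := lo f1 y1 f1_ge0 g1 h1 h1'.
have /andP[l2 u2] := lo f2 y2 f2_ge0 g2 h2 h2'.
have /andP[l3 u3] := lo f3 y3 f3_ge0 g3 h3 h3'.
by split; rewrite /Z; lra.
Qed.

(** The numerator is [b0 * Yp + c0 * Fp], with [Yp] from the variation of [y] and [Fp] from that of
    [f]. With both bounded, the claim is [balance <= 0] multiplied by [b0 * c0 * eps]. *)
Lemma two_layer_contraction : 0 <= eps ->
  regime th f0 f1 f2 f3 -> 0 <= f0 -> 0 <= f1 -> 0 <= f2 -> 0 <= f3 ->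
  f0 + f1 + f2 + f3 = 1 ->
  0 <= y0 <= 1/2 -> 0 <= y1 <= 1/2 -> 0 <= y2 <= 1/2 -> 0 <= y3 <= 1/2 ->
  `|d0| <= eps * Phi y0 -> `|d1| <= eps * Phi y1 ->
  `|d2| <= eps * Phi y2 -> `|d3| <= eps * Phi y3 ->
  `|q0| <= th * eps -> `|q1| <= th * eps -> `|q2| <= th * eps -> `|q3| <= th * eps ->
  `|(da f0 y0 q0 d0 * Z - a f0 y0 * dZ) / Z ^+ 2| <= rate R * eps * Phi (a f0 y0 / Z).
Proof.
move=> eps_ge0 Hreg f0_ge0 f1_ge0 f2_ge0 f3_ge0 fE hy0 hy1 hy2 hy3 hd0 hd1 hd2 hd3 hq0 hq1 hq2 hq3.
have [Z_gt0 a0_ge _] := two_layer_bounds Hreg f0_ge0 f1_ge0 f2_ge0 f3_ge0 fE hy0 hy1 hy2 hy3.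
have a0_gt0 : 0 < a f0 y0 by apply: lt_le_trans a0_ge; rewrite divr_gt0.
have c0_rng := half_compl hy0.
have [p1 p2 p3] : [/\ 0 <= 1 - y1, 0 <= 1 - y2 & 0 <= 1 - y3].
  by split; apply: half_compl_ge0.
pose c0 := 1 - y0; pose c1 := 1 - y1; pose c2 := 1 - y2; pose c3 := 1 - y3.
pose b0 := 1 - f0.
have c0_gt0 : 0 < c0 by have /andP[le_c0 _] := c0_rng; apply: lt_le_trans le_c0; rewrite divr_gt0.
have b0_gt0 : 0 < b0 by move: a0_gt0; rewrite /a pmulr_lgt0//; rewrite -/c0.
have b0E : b0 = f1 + f2 + f3 by rewrite /b0 -fE; ring.
pose psi := (1 - c0) * (c0 - (1 - kap R)) / c0.
have psiE : c0 * psi = (1 - c0) * (c0 - (1 - kap R)) by rewrite /psi mulrC divfK ?gt_eqF.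
have [s1 [s2 [s3 [m [hs m1 m2 m3]]]]] := range_pattern c1 c2 c3.
set r := s1 * c1 + s2 * c2 + s3 * c3 in m1 m2 m3.
have Hbal := balance_le0 Hreg f0_ge0 fE psiE c0_rng p1 p2 p3 hs.
rewrite -/r in Hbal.
set tau := th * eps.
(* The first two lines form a covariance under [f1, f2, f3], where the derivatives partly cancel;
   the third compares these colors with color 0. *)
pose Fp := b0 * (f1 * c1 * q1 + f2 * c2 * q2 + f3 * c3 * q3)
    - (f1 * c1 + f2 * c2 + f3 * c3) * (f1 * q1 + f2 * q2 + f3 * q3)
   + f0 * (c1 + c2 + c3) * (f1 * (q1 - q0) + f2 * (q2 - q0) + f3 * (q3 - q0)).
have FpE : `|Fp| <= b0 * (th * eps * (2 * f0 * (c1 + c2 + c3) + b0 * r / 2)).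
  have := covariance_le f1_ge0 f2_ge0 f3_ge0 m1 m2 m3 hq1 hq2 hq3; rewrite -b0E => Hcov.
  have Hm : `|f1 * (q1 - q0) + f2 * (q2 - q0) + f3 * (q3 - q0)| <= f1 * (tau + tau) + f2 * (tau + tau) + f3 * (tau + tau).
    by apply: normrD_le; [apply: normrD_le|]; apply: normrM_le => //; apply: normrB_le.
  have Hc : 0 <= f0 * (c1 + c2 + c3) by apply: mulr_ge0 => //; apply: addr_ge0 => //; exact: addr_ge0.
  apply: le_trans (normrD_le Hcov (normrM_le Hc Hm)) _.
  by apply: ler_of_eq; rewrite -!mulrDl -b0E /tau; field.
pose Yp := (1 - f1) * (c0 * d1 - c1 * d0) + (1 - f2) * (c0 * d2 - c2 * d0) + (1 - f3) * (c0 * d3 - c3 * d0).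
have [b1_ge0 b2_ge0 b3_ge0] : [/\ 0 <= 1 - f1, 0 <= 1 - f2 & 0 <= 1 - f3].
  rewrite -fE; split; [rewrite (_ : _ - _ = f0 + f2 + f3)|rewrite (_ : _ - _ = f0 + f1 + f3)
    |rewrite (_ : _ - _ = f0 + f1 + f2)]; try ring; by do 2?apply: addr_ge0.
have YpE : `|Yp| <= (1 - f1) * (c0 * (eps * Phi y1) + c1 * (eps * Phi y0))
   + (1 - f2) * (c0 * (eps * Phi y2) + c2 * (eps * Phi y0))
   + (1 - f3) * (c0 * (eps * Phi y3) + c3 * (eps * Phi y0)).
  by apply: normrD_le; [apply: normrD_le|]; (apply: normrM_le; [by []|apply: normrB_le]; apply: normrM_le => //; exact: ltW).
have NE : da f0 y0 q0 d0 * Z - a f0 y0 * dZ = b0 * Yp + c0 * Fp.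
  rewrite /dZ /Z /Yp /Fp /da /a /qm /c0 /c1 /c2 /c3 /b0.
  have -> : f3 = 1 - f0 - f1 - f2 by rewrite -fE; ring.
  ring.
have Z2 : 0 < Z ^+ 2 by rewrite exprn_gt0.
rewrite NE normrM normfV (ger0_norm (ltW Z2)) ler_pdivrMr//.
have -> : rate R * eps * Phi (a f0 y0 / Z) * Z ^+ 2 = rate R * eps * (a f0 y0 * (kap R * Z - a f0 y0)).
  by rewrite /Phi; field; rewrite gt_eqF.
have b0_ge0 := ltW b0_gt0; have c0_ge0 := ltW c0_gt0.
apply: le_trans (normrD_le (normrM_le b0_ge0 YpE) (normrM_le c0_ge0 FpE)) _.
rewrite -subr_le0.
have Phi0 : Phi y0 = c0 * psi by rewrite psiE /Phi /c0; ring.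
have key : 0 <= b0 * c0 * eps * (- balance th f0 f1 f2 f3 c0 psi c1 c2 c3 r).
  by apply: mulr_ge0; [apply: mulr_ge0 => //; exact: mulr_ge0|rewrite oppr_ge0].
rewrite -oppr_ge0; apply: le_trans key _; apply: ler_of_eq.
rewrite Phi0 /balance /Z /a /Phi -/c0 -/c1 -/c2 -/c3 -/b0.
have -> : y1 = 1 - c1 by rewrite /c1; ring.
have -> : y2 = 1 - c2 by rewrite /c2; ring.
have -> : y3 = 1 - c3 by rewrite /c3; ring.
by rewrite -/b0; field.
Qed.

End TwoLayer.
End Contraction.

(** * Contraction at a vertex of degree one *)

Section OneLayer.
Variable R : realFieldType.

Lemma Phi_ge0 (x : R) : 0 <= x <= 1/2 -> 0 <= Phi x.
Proof. by move=> /andP[x0 x1]; rewrite /Phi /kap mulr_ge0//; lra. Qed.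

Lemma Phi_le (x : R) : Phi x <= 1.
Proof.
have H : 0 <= (x - 507/2000) ^+ 2 by exact: sqr_ge0.
rewrite /Phi /kap; nra. Qed.

(** Controls the logarithmic derivative of [1 - x]. The square in the proof is centred near the
    maximiser [1 - sqrt (1 - kap)]. *)
Lemma Phi_compl_le (x : R) : 0 <= x <= 1/2 -> Phi x / (1 - x) <= psimax R.
Proof.
move=> /andP[x0 x1]; rewrite ler_pdivrMr; last by lra.
have H : 0 <= (x - 297/1000) ^+ 2 by exact: sqr_ge0.
rewrite /Phi /kap /psimax; nra.
Qed.

(** What the contraction of [(1 - x) / (2 + y)] amounts to once [eps] and the denominators are
    cleared. For [y = 0] the margin is smallest near [x = 1/50]. *)
Lemma one_layer_ineq (x y : R) : 0 <= x <= 1/2 -> 0 <= y <= 1/2 ->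
  Phi x * (2 + y) + (1 - x) * Phi y <= rate R * ((1 - x) * (kap R * (2 + y) - (1 - x))).
Proof.
move=> /andP[x0 x1] /andP[y0 y1]; rewrite /Phi /kap /rate.
have h1 : 0 <= x * y by exact: mulr_ge0.
have h2 : 0 <= (1/2 - x) * y by rewrite mulr_ge0//; lra.
have h3 : 0 <= x * y * (1/2 - x) by rewrite mulr_ge0//; lra.
have h4 : 0 <= (1/2 - x) * y ^+ 2 by rewrite mulr_ge0 ?sqr_ge0//; lra.
have h5 : 0 <= (x - 1/50) ^+ 2 by exact: sqr_ge0.
nra.
Qed.

(** The zeros are the derivatives of the constants 1 and 2, kept to match the form produced by the
    quotient rule. *)
Lemma one_layer_contraction (eps x y dx dy : R) :
  0 <= x <= 1/2 -> 0 <= y <= 1/2 -> 0 <= eps ->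
  `|dx| <= eps * Phi x -> `|dy| <= eps * Phi y ->
  `|((0 - dx) * (2 + y) - (1 - x) * (0 + dy)) / (2 + y) ^+ 2|
    <= rate R * eps * Phi ((1 - x) / (2 + y)).
Proof.
move=> hx hy e0 hdx hdy; have ineq := one_layer_ineq hx hy.
have [x0 x1] := andP hx; have [y0 y1] := andP hy.
have y2 : 0 < 2 + y by lra.
have y22 : 0 < (2 + y) ^+ 2 by rewrite exprn_gt0.
rewrite normrM normfV (gtr0_norm y22) ler_pdivrMr//.
have -> : rate R * eps * Phi ((1 - x) / (2 + y)) * (2 + y) ^+ 2 =
   eps * (rate R * ((1 - x) * (kap R * (2 + y) - (1 - x)))).
  by rewrite /Phi; field; rewrite gt_eqF.
apply: le_trans (ler_wpM2l e0 ineq).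
have -> : (0 - dx) * (2 + y) - (1 - x) * (0 + dy) = - ((2 + y) * dx + (1 - x) * dy) by ring.
rewrite normrN; apply: le_trans (normrD_le (normrM_le (ltW y2) hdx) (normrM_le (half_compl_ge0 hx) hdy)) _.
by apply: ler_of_eq; ring.
Qed.

Lemma third_contraction (eps x dx : R) : 0 <= x <= 1/2 -> 0 <= eps ->
  `|dx| <= eps * Phi x -> `|(0 - dx) / 3| <= rate R * eps * Phi ((1 - x) / 3).
Proof.
move=> hx e0 hdx; rewrite sub0r normrM normrN.
have -> : `|3^-1| = 3^-1 :> R by rewrite ger0_norm// invr_ge0.
rewrite ler_pdivrMr//; apply: le_trans hdx _.
have -> : rate R * eps * Phi ((1 - x) / 3) * 3 = eps * (rate R * (3 * Phi ((1 - x) / 3))) by ring.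
apply: ler_wpM2l => //; have [x0 x1] := andP hx; rewrite /rate /Phi /kap; nra.
Qed.
End OneLayer.

(** * The law of the first neighbour *)

Section InnerLayer.
Variables (R : realFieldType) (n : nat) (L1 : {set 'I_4}).

Definition inner_prod (x : 'I_n -> 'I_4 -> R) (w : 'I_4) : R := \prod_(k < n) (1 - x k w).

Definition inner (x : 'I_n -> 'I_4 -> R) (w : 'I_4) : R :=
  if w \in L1 then inner_prod x w / \sum_(w' in L1) inner_prod x w' else 0.

(** The sum runs over all four colors because a vertex of degree 2 below the root has the full
    list. *)
Definition outer (f y : 'I_4 -> R) (i : 'I_4) : R :=
  (1 - f i) * (1 - y i) / \sum_j (1 - f j) * (1 - y j).

Variable x : 'I_n -> 'I_4 -> R.
Hypothesis hL : (n + 2 <= #|L1|)%N.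
Hypothesis hx : forall k w, w \in L1 -> 0 <= x k w <= 1/2.
Local Notation g := (inner_prod x).
Local Notation G := (\sum_(w in L1) g w).

Lemma inner_prod_bounds w : w \in L1 -> (1/2) ^+ n <= g w <= 1.
Proof.
move=> wL; rewrite /inner_prod -[n in _ ^+ n]card_ord -prodr_const; apply/andP; split.
  apply: ler_prod => k _; have /andP[h1 h2] := half_compl (hx k wL).
  by rewrite h1 andbT divr_ge0.
apply: prodr_ile1 => k _; have /andP[h1 ->] := half_compl (hx k wL); rewrite andbT.
by apply: le_trans h1; rewrite divr_ge0.
Qed.

Lemma inner_prod_gt0 w : w \in L1 -> 0 < g w.
Proof.
by move=> /inner_prod_bounds/andP[h _]; apply: lt_le_trans h; rewrite exprn_gt0 ?divr_gt0.
Qed.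

Lemma inner_sum_bounds w : w \in L1 ->
  g w + (#|L1|.-1)%:R * (1/2) ^+ n <= G <= g w + (#|L1|.-1)%:R.
Proof.
move=> wL; rewrite (big_setD1 w wL) /= !lerD2l.
have -> : #|L1|.-1 = #|L1 :\ w| by rewrite (cardsD1 w L1) wL.
rewrite mulr_natl -[X in _ <= _ <= X]mulr1 mulr_natl -!sumr_const.
by apply/andP; split; apply: ler_sum => w' /setD1P[_ /inner_prod_bounds/andP[]].
Qed.

Lemma inner_sum_gt0 : 0 < G.
Proof.
have /card_gt0P[w wL] : (0 < #|L1|)%N by apply: leq_trans hL; rewrite addn2.
by rewrite (big_setD1 w wL) /= ltr_wpDr ?inner_prod_gt0// sumr_ge0// => w' /setD1P[_ /inner_prod_gt0/ltW].
Qed.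

Lemma inner_ge0 w : 0 <= inner x w.
Proof.
rewrite /inner; case: ifP => // wL.
by apply: divr_ge0; apply: ltW; [exact: inner_prod_gt0|exact: inner_sum_gt0].
Qed.

Lemma inner_sum1 : \sum_w inner x w = 1.
Proof.
rewrite (bigID (mem L1)) /= [X in _ + X]big1 ?addr0; last first.
  by move=> w wL; rewrite /inner (negbTE wL).
under eq_bigr => w wL do rewrite /inner wL.
by rewrite -mulr_suml divff // gt_eqF ?inner_sum_gt0.
Qed.

Lemma inner_arity : (n <= 2)%N.
Proof. by rewrite -(leq_add2r 2); apply: leq_trans hL _; apply: leq_trans (max_card _) _; rewrite card_ord. Qed.

(** The other colors contribute at least [n + 1] terms, each at least [(1/2) ^+ n]; for [n <= 1]
    they total at least 1, hence at least [g w]. *)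
Lemma inner_le_half w : (n <= 1)%N -> inner x w <= 1/2.
Proof.
move=> n1; rewrite /inner; case: ifP => wL; last by rewrite divr_ge0.
rewrite ler_pdivrMr ?inner_sum_gt0//.
have /andP[lo _] := inner_sum_bounds wL.
have /andP[_ gw1] := inner_prod_bounds wL.
suff : 1 <= (#|L1|.-1)%:R * (1/2) ^+ n :> R by lra.
have : n.+1%:R <= (#|L1|.-1)%:R :> R by rewrite ler_nat -ltnS; move: hL; case: #|L1|; rewrite ?addn2.
case: n n1 => [|[|//]] _; rewrite ?expr0 ?expr1; lra.
Qed.

(** The list is full and all four products lie in [1/4, 1], so the extremes are [(1/4) / (1/4 + 3)]
    and [1 / (1 + 3/4)]. *)
Lemma inner_bounds w : n = 2%N -> 1/13 <= inner x w <= 4/7.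
Proof.
move=> n2; have cL : #|L1| = 4%N.
  apply/eqP; rewrite eqn_leq; move: hL; rewrite n2 => ->; rewrite andbT.
  by apply: leq_trans (max_card _) _; rewrite card_ord.
have wL : w \in L1.
  have /eqP -> : L1 == setT by rewrite eqEcard subsetT cardsT card_ord cL.
  by rewrite inE.
rewrite /inner wL ler_pdivlMr ?ler_pdivrMr ?inner_sum_gt0//.
have /andP[lo hi] := inner_sum_bounds wL; have /andP[glo ghi] := inner_prod_bounds wL.
move: lo hi glo; rewrite cL n2 /= expr2 => lo hi glo.
by apply/andP; split; lra.
Qed.

(** Each of the [n] factors adds at most [psimax] to the logarithmic derivative, per unit of [eps];
    [n = 0] is grouped with [n = 1]. *)
Definition inner_rate : R := if n == 2 then 2 * psimax R else psimax R.

Lemma inner_regime w0 w1 w2 w3 :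
  regime inner_rate (inner x w0) (inner x w1) (inner x w2) (inner x w3).
Proof.
rewrite /regime /inner_rate; case: eqP => [n2|n2].
  right; split=> //; split; rewrite ?inner_bounds//.
  - by have /andP[] := inner_bounds w1 n2.
  - by have /andP[] := inner_bounds w2 n2.
  - by have /andP[] := inner_bounds w3 n2.
left; split=> //; have n1 : (n <= 1)%N.
  by rewrite -ltnS ltn_neqAle inner_arity andbT; apply/eqP.
by split; apply: inner_le_half.
Qed.

Lemma inner_rate_ge0 : 0 <= inner_rate.
Proof.
have h : 0 <= psimax R by rewrite divr_ge0.
by rewrite /inner_rate; case: ifP => _ //; apply: mulr_ge0.
Qed.

Lemma inner_rate_ge : n%:R * psimax R <= inner_rate.
Proof.
rewrite /inner_rate; have := inner_arity; have : 0 <= psimax R by rewrite divr_ge0.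
by case: n => [|[|[|//]]] /= h _; rewrite ?mul0r ?mul1r.
Qed.

End InnerLayer.

(** * Exact marginals *)

Section Count.
Variables (T : finType) (e : rel T).
Hypotheses (e_sym : symmetric e) (e_irr : irreflexive e).
Implicit Types (S : {set T}) (L : T -> {set 'I_4}) (v u w : T) (i j : 'I_4)
  (c : {ffun T -> 'I_4}) (s ns : seq T).

(* Colorings of the subgraph induced on [S]; outside [S] they take the dummy value [ord0]. *)
Definition pcol S L c : bool :=
  [forall u, if u \in S then c u \in L u else c u == ord0] &&
  [forall u in S, forall w in S, e u w ==> (c u != c w)].

Lemma pcolP S L c : reflect
  [/\ forall u, u \in S -> c u \in L u, forall u, u \notin S -> c u = ord0 &
      forall u w, u \in S -> w \in S -> e u w -> c u != c w] (pcol S L c).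
Proof.
apply: (iffP andP) => [[/forallP h1 /forall_inP h2]|[h1 h2 h3]]; split.
- by move=> u uS; have := h1 u; rewrite uS.
- by move=> u uS; have := h1 u; rewrite (negbTE uS) => /eqP.
- by move=> u w uS wS; have /forall_inP/(_ w wS)/implyP := h2 u uS.
- by apply/forallP => u; case: ifPn => uS; [apply: h1|rewrite h2].
- by apply/forall_inP => u uS; apply/forall_inP => w wS; apply/implyP; apply: h3.
Qed.

Definition nbr S v : {set T} := [set w in S | e v w].

Definition ncol S L : nat := #|[set c | pcol S L c]|.
Definition ncolv S L v i : nat := #|[set c | pcol S L c & c v == i]|.

Lemma ncol_sum S L v : ncol S L = (\sum_i ncolv S L v i)%N.
Proof.
rewrite /ncol -sum1_card (partition_big (fun c : {ffun T -> 'I_4} => c v) predT) //=.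
by apply: eq_bigr => i _; rewrite /ncolv -sum1_card; apply: eq_bigl => c; rewrite !inE.
Qed.

Lemma ncolv_notin S L v i : v \in S -> i \notin L v -> ncolv S L v i = 0%N.
Proof.
move=> vS iL; apply/eqP; rewrite cards_eq0; apply/eqP/setP => c; rewrite !inE.
apply/negP => /andP[/pcolP[h _ _] /eqP cv]; move: (h v vS); rewrite cv; exact/negP.
Qed.

(** Fixing the color [i] at [v] amounts to deleting [v] and forbidding [i] at its neighbours;
    [upd i] is the bijection and [upd ord0] its inverse. *)
Lemma ncolv_delete S L v i ns : v \in S -> i \in L v -> ns =i nbr S v ->
  ncolv S L v i = ncol (S :\ v) (remove_on ns i L).
Proof.
move=> vS iL nsE.
pose upd (a : 'I_4) (c : {ffun T -> 'I_4}) := [ffun u => if u == v then a else c u].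
rewrite /ncol -(card_in_imset (f := upd i)); last first.
  move=> c1 c2; rewrite !inE => /pcolP[_ h1 _] /pcolP[_ h2 _] /ffunP eq12.
  apply/ffunP => u; have := eq12 u; rewrite !ffunE; case: eqP => // -> _.
  by rewrite h1 ?h2// !inE eqxx.
apply: eq_card => c; rewrite !inE; apply/idP/imsetP.
  case/andP => /pcolP[h1 h2 h3] /eqP cv; exists (upd ord0 c); last first.
    by apply/ffunP => u; rewrite !ffunE; case: eqP => // ->.
  rewrite inE; apply/pcolP; split.
  - move=> u; rewrite !inE => /andP[uv uS]; rewrite ffunE (negbTE uv) /remove_on nsE inE uS /=.
    case: ifP => [evu|_]; last exact: h1.
    by rewrite !inE (h1 _ uS) andbT -cv eq_sym h3.
  - by move=> u; rewrite !inE negb_and negbK ffunE; case: eqP => //= _ /h2.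
  - move=> u w; rewrite !inE => /andP[uv uS] /andP[wv wS]; rewrite !ffunE (negbTE uv) (negbTE wv).
    exact: h3.
move=> [c']; rewrite inE => /pcolP[h1 h2 h3] ->; apply/andP; split; last by rewrite ffunE eqxx.
have hL u : u != v -> u \in S -> c' u \in L u.
  by move=> uv uS; have := h1 u; rewrite !inE uv uS /remove_on => /(_ isT); case: ifP; rewrite ?inE // => _ /andP[].
have hi u : u \in S -> e v u -> c' u != i.
  move=> uS evu; have uv : u != v by apply/eqP => uv; rewrite uv e_irr in evu.
  by have := h1 u; rewrite !inE uv uS /remove_on nsE inE uS evu /= !inE => /(_ isT) /andP[].
apply/pcolP; split.
- by move=> u uS; rewrite ffunE; case: eqP => [->//|/eqP uv]; apply: hL.
- move=> u uS; rewrite ffunE; case: eqP => [uv|_]; first by rewrite uv vS in uS.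
  by apply: h2; rewrite !inE negb_and uS orbT.
- move=> u w uS wS euw; rewrite !ffunE; case: (eqVneq u v) => [uv|uv]; case: (eqVneq w v) => [wv|wv].
  + by rewrite uv wv e_irr in euw.
  + by rewrite eq_sym hi // -uv.
  + by rewrite hi // e_sym -wv.
  + by apply: h3; rewrite ?inE ?uv ?wv.
Qed.

(** Colorings are split according to whether [u] receives [j]. *)
Lemma ncol_remove S L u j s : u \in S -> u \notin s ->
  ncol S (remove_on s j L) =
  (ncolv S (remove_on s j L) u j + ncol S (remove_on (rcons s u) j L))%N.
Proof.
move=> uS us; rewrite /ncol -(cardsID [set c : {ffun T -> 'I_4} | c u == j]).
congr (_ + _)%N; apply: eq_card => c; rewrite !inE //.
apply/andP/pcolP => [[cu /pcolP[h1 h2 h3]]|[h1 h2 h3]].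
  split=> // w wS; have := h1 w wS; rewrite /remove_on mem_rcons inE.
  by case: eqVneq => [->|//] /=; rewrite (negbTE us) !inE cu => ->.
have := h1 u uS; rewrite /remove_on mem_rcons inE eqxx /= !inE => /andP[cu _]; split=> //.
apply/pcolP; split=> // w wS; have := h1 w wS; rewrite /remove_on mem_rcons inE.
by case: eqVneq => [->|//] /=; rewrite (negbTE us) inE => /andP[].
Qed.

Definition valid S L := forall u, u \in S -> (#|nbr S u| < #|L u|)%N.

Lemma card_nbr_delete S u v : v \in S -> e v u -> #|nbr S u| = #|nbr (S :\ v) u|.+1.
Proof.
move=> vS evu; rewrite (cardsD1 v) inE vS e_sym evu add1n; congr _.+1.
by apply: eq_card => w; rewrite !inE andbA.
Qed.

(** A neighbour that loses the color [j] has also lost its edge to [v]. *)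
Lemma valid_delete S L v s j : v \in S -> {subset s <= nbr S v} -> valid S L ->
  valid (S :\ v) (remove_on s j L).
Proof.
move=> vS sub hv u; rewrite !inE => /andP[uv uS].
have hu := hv u uS.
have le_nbr : (#|nbr (S :\ v) u| <= #|nbr S u|)%N.
  by apply/subset_leq_card/subsetP => w; rewrite !inE => /andP[/andP[_ ->] ->].
rewrite /remove_on; case: ifPn => us; last exact: leq_ltn_trans hu.
have /setIdP[_ evu] := sub u us.
move: hu; rewrite (card_nbr_delete vS evu) (cardsD1 j (L u)).
by case: (j \in L u) => /=; rewrite ?add1n ?add0n // => /ltnW.
Qed.

(** The edge to [v] is gone while the list of [u] is intact: this is the source of the extra spare
    color below the root. *)
Lemma slack_delete S L v u s j : v \in S -> u \in nbr S v -> u \notin s -> valid S L ->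
  (#|nbr (S :\ v) u| + 2 <= #|remove_on s j L u|)%N.
Proof.
move=> vS /setIdP[uS evu] us hv; rewrite /remove_on (negbTE us) addn2 -(card_nbr_delete vS evu).
exact: hv.
Qed.

(** Greedy coloring: any color in the list of [v] leaves a valid smaller instance. *)
Lemma ncol_gt0 S L : valid S L -> (0 < ncol S L)%N.
Proof.
have [n] := ubnP #|S|; elim: n S L => // n IHn S L; rewrite ltnS => leSn hv.
have [->|[v vS]] := set_0Vmem S.
  rewrite /ncol card_gt0; apply/set0Pn; exists [ffun=> ord0]; rewrite inE; apply/pcolP.
  by split=> [u|u _|u w]; rewrite ?inE ?ffunE.
have /card_gt0P[i iL] : (0 < #|L v|)%N by apply: leq_ltn_trans (hv v vS).
rewrite (ncol_sum S L v) (bigD1 i) //= addn_gt0.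
rewrite (@ncolv_delete _ _ _ _ (enum (nbr S v))) // ?IHn //.
- by move: leSn; rewrite (cardsD1 v S) vS.
- by apply: valid_delete => // w; rewrite mem_enum.
- by move=> w; rewrite mem_enum.
Qed.

Variable R : realFieldType.

Definition mu S L v i : R := (ncolv S L v i)%:R / (ncol S L)%:R.

Definition gprod S L v ns i : R :=
  \prod_(k < size ns) (1 - mu (S :\ v) (remove_on (take k ns) i L) (nth v ns k) i).

Lemma mu_notin S L v i : v \in S -> i \notin L v -> mu S L v i = 0.
Proof. by move=> vS iL; rewrite /mu ncolv_notin // mul0r. Qed.

Lemma mu_sum S L v : valid S L -> \sum_i mu S L v i = 1.
Proof.
move=> hv; rewrite -mulr_suml -natr_sum -ncol_sum divff // pnatr_eq0 -lt0n; exact: ncol_gt0.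
Qed.

(** Telescoping: by [ncol_remove], each factor is the ratio of two consecutive counts. *)
Lemma ncol_remove_prod S L v ns i m : v \in S -> uniq ns -> ns =i nbr S v -> valid S L ->
  (m <= size ns)%N ->
  (ncol (S :\ v) (remove_on (take m ns) i L))%:R =
  (ncol (S :\ v) L)%:R *
  \prod_(k < m) (1 - mu (S :\ v) (remove_on (take k ns) i L) (nth v ns k) i) :> R.
Proof.
move=> vS un nsE hv; elim: m => [|m IHm] lt_m; first by rewrite big_ord0 mulr1 take0.
have mem_m : nth v ns m \in nbr S v by rewrite -nsE mem_nth.
have notin_m : nth v ns m \notin take m ns.
  by rewrite in_take_leq ?index_uniq ?ltnn // ltnW.
have in_Sv : nth v ns m \in S :\ v.
  move: mem_m; rewrite !inE => /andP[-> evn]; rewrite andbT.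
  by apply/eqP => E; rewrite E e_irr in evn.
have hv' : valid (S :\ v) (remove_on (take m ns) i L).
  by apply: valid_delete => // w /mem_take; rewrite nsE.
have gt0 := ncol_gt0 hv'.
rewrite big_ord_recr /= mulrA -IHm; last exact: ltnW.
rewrite (take_nth v lt_m).
have := ncol_remove L i in_Sv notin_m => /(congr1 (fun n => n%:R : R)); rewrite natrD => E.
rewrite /mu mulrBr mulr1 [_ * (_ / _)]mulrC divfK; first by rewrite {1}E [RHS]addrAC subrr add0r.
by rewrite pnatr_eq0 -lt0n.
Qed.

Lemma ncolv_prod S L v ns i : v \in S -> uniq ns -> ns =i nbr S v -> valid S L -> i \in L v ->
  (ncolv S L v i)%:R = (ncol (S :\ v) L)%:R * gprod S L v ns i.
Proof.
move=> vS un nsE hv iL; rewrite (ncolv_delete vS iL nsE) /gprod.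
by rewrite -ncol_remove_prod // take_size.
Qed.

Lemma mu_prod S L v ns i : v \in S -> uniq ns -> ns =i nbr S v -> valid S L -> i \in L v ->
  mu S L v i = gprod S L v ns i / \sum_(j in L v) gprod S L v ns j.
Proof.
move=> vS un nsE hv iL; rewrite /mu (ncolv_prod vS un nsE hv iL).
have -> : (ncol S L)%:R = (ncol (S :\ v) L)%:R * \sum_(j in L v) gprod S L v ns j :> R.
  rewrite (ncol_sum S L v) natr_sum mulr_sumr (bigID (mem (L v))) /= [X in _ + X]big1 ?addr0.
    by apply: eq_bigr => j jL; exact: ncolv_prod.
  by move=> j jL; rewrite ncolv_notin.
rewrite invfM mulrACA divff ?mul1r // pnatr_eq0 -lt0n; apply: ncol_gt0.
by apply: (@valid_delete S L v [::] i).
Qed.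

End Count.

Lemma card_colors (A : {set 'I_4}) : (#|A| <= 4)%N.
Proof. by apply: leq_trans (max_card _) _; rewrite card_ord. Qed.

Lemma full_colors (A : {set 'I_4}) : (4 <= #|A|)%N -> A = setT.
Proof. by move=> A4; apply/eqP; rewrite eqEcard subsetT cardsT card_ord. Qed.

Lemma inner_lower (R : realFieldType) n (L1 : {set 'I_4}) (x : 'I_n -> 'I_4 -> R) w :
  (n + 2 <= #|L1|)%N -> (forall k w, w \in L1 -> 0 <= x k w <= 1/2) -> w \in L1 ->
  1/16 <= inner L1 x w.
Proof.
move=> hL hx wL; rewrite /inner wL ler_pdivlMr ?(inner_sum_gt0 hL hx) //.
have /andP[_ hi] := inner_sum_bounds hx wL; have /andP[glo ghi] := inner_prod_bounds hx wL.
have h3 : (#|L1|.-1)%:R <= 3 :> R by rewrite ler_nat -ltnS prednK ?card_colors // (leq_trans _ hL) ?addn2.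
have h4 : 1/4 <= (1/2) ^+ n :> R.
  by have := inner_arity hL; case: n {x hL hx hi glo ghi} => [|[|[|//]]] _; rewrite ?expr0 ?expr1 ?expr2; lra.
lra.
Qed.

Lemma sub_sum_compl (R : pzRingType) (x : 'I_4 -> R) : \sum_j x j = 1 -> \sum_j (1 - x j) = 3.
Proof. by move=> xE; rewrite sumrB xE sumr_const card_ord mulrSr addrK. Qed.

(** The source of the denominator [2 + y] in the recursion for one neighbour and three colors. *)
Lemma sum_compl_missing (R : comPzRingType) (x : 'I_4 -> R) (A : {set 'I_4}) j :
  #|A| = 3%N -> j \notin A -> \sum_j x j = 1 -> \sum_(j in A) (1 - x j) = 2 + x j.
Proof.
move=> A3 jA xE.
have AE : A = [set: 'I_4] :\ j.
  apply/eqP; rewrite eqEcard A3 cardsDS ?subsetT // cardsT card_ord cards1 andbT.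
  by apply/subsetP => j' j'A; rewrite !inE andbT; apply/eqP => jj; rewrite jj (negbTE jA) in j'A.
have : \sum_(j' in [set: 'I_4]) (1 - x j') = 3.
  by rewrite -(sub_sum_compl xE); apply: eq_bigl => j'; rewrite inE.
rewrite (big_setD1 j) ?inE //= -AE => H.
by apply: (addrI (1 - x j)); rewrite H; ring.
Qed.

Lemma sum_pair (V : zmodType) (F : 'I_4 -> V) (A : {set 'I_4}) i :
  #|A| = 2%N -> i \in A -> \sum_(j in A) F j = F i + F (odflt i [pick j in A :\ i]).
Proof.
move=> A2 iA; rewrite (big_setD1 i iA) /=; congr (_ + _).
have : #|A :\ i| == 1%N by move: A2; rewrite (cardsD1 i) iA add1n => -[->].
move=> /cards1P[j AE]; rewrite AE big_set1; case: pickP => [k|/(_ j)]; rewrite inE ?eqxx //.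
by move=> /eqP ->.
Qed.

(** The quantifiers over [V] and [F] come last, so that the same three colors serve all sums. *)
Lemma four_colors (i : 'I_4) : exists j1 j2 j3 : 'I_4,
  forall (V : zmodType) (F : 'I_4 -> V), \sum_j F j = F i + F j1 + F j2 + F j3.
Proof.
have S (V : zmodType) (F : 'I_4 -> V) :
    \sum_j F j = F (inord 0) + F (inord 1) + F (inord 2) + F (inord 3).
  rewrite !big_ord_recl big_ord0 addr0 !addrA.
  by congr (_ + _ + _ + _); congr F; apply: val_inj; rewrite /= inordK.
have [-> | -> | -> | ->] : [\/ i = inord 0, i = inord 1, i = inord 2 | i = inord 3].
  case: i => -[|[|[|[|//]]]] lti; [constructor 1|constructor 2|constructor 3|constructor 4];
    by apply: val_inj; rewrite /= inordK.
- by exists (inord 1), (inord 2), (inord 3).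
- by exists (inord 0), (inord 2), (inord 3) => V F; rewrite S [F (inord 1) + _]addrC.
- by exists (inord 0), (inord 1), (inord 3) => V F; rewrite S; congr (_ + _); rewrite -[RHS]addrA [RHS]addrC.
- by exists (inord 0), (inord 1), (inord 2) => V F; rewrite S addrC !addrA.
Qed.

(** * Marginals of vertices with two spare colors *)

Section Good.
Variables (T : finType) (e : rel T).
Hypotheses (e_sym : symmetric e) (e_irr : irreflexive e).
Implicit Types (S : {set T}) (L : T -> {set 'I_4}) (v u w : T) (i j : 'I_4) (ns : seq T).

(** The invariant of all queries below the root. *)
Definition good S L v := [/\ v \in S, valid e S L & (#|nbr e S v| + 2 <= #|L v|)%N].

Lemma good_child S L v ns j k : v \in S -> valid e S L -> uniq ns -> ns =i nbr e S v ->
  (k < size ns)%N -> good (S :\ v) (remove_on (take k ns) j L) (nth v ns k).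
Proof.
move=> vS hv un nsE lt_k; have mem_k : nth v ns k \in nbr e S v by rewrite -nsE mem_nth.
split.
- move: mem_k; rewrite !inE => /andP[-> evn]; rewrite andbT.
  by apply/eqP => E; rewrite E e_irr in evn.
- by apply: valid_delete => // w /mem_take; rewrite nsE.
- by apply: slack_delete => //; rewrite in_take_leq ?index_uniq ?ltnn // ltnW.
Qed.

Lemma good_size S L v ns : uniq ns -> ns =i nbr e S v -> good S L v -> (size ns + 2 <= #|L v|)%N.
Proof. by move=> un nsE [_ _]; rewrite -(eq_card nsE) (card_uniqP un). Qed.

Variable R : realFieldType.
Local Notation mu := (@mu T e R).

Definition children S L v ns (k : 'I_(size ns)) (j : 'I_4) : R :=
  mu (S :\ v) (remove_on (take k ns) j L) (nth v ns k) j.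

Lemma mu_inner S L v ns i : v \in S -> uniq ns -> ns =i nbr e S v -> valid e S L ->
  mu S L v i = inner (L v) (@children S L v ns) i.
Proof.
move=> vS un nsE hv; rewrite /inner; case: ifPn => iL; last exact: mu_notin.
exact: mu_prod.
Qed.

Lemma mu_pair_list S L v a b i : v \in S -> uniq [:: a; b] -> [:: a; b] =i nbr e S v ->
  valid e S L -> i \in L v ->
  let t j := (1 - mu (S :\ v) L a j) * (1 - mu (S :\ v) (remove_on [:: a] j L) b j) in
  mu S L v i = t i / \sum_(j in L v) t j.
Proof.
move=> vS un nsE hv iL t; rewrite (mu_prod _ _ _ vS un nsE hv) //.
have gE j : gprod e R S L v [:: a; b] j = t j by rewrite /gprod !big_ord_recl big_ord0 mulr1.
by rewrite gE; under eq_bigr do rewrite gE.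
Qed.

Lemma mu_pair S L v a b i : v \in S -> uniq [:: a; b] -> [:: a; b] =i nbr e S v ->
  valid e S L -> L v = setT ->
  mu S L v i = outer (mu (S :\ v) L a) (fun j => mu (S :\ v) (remove_on [:: a] j L) b j) i.
Proof.
move=> vS un nsE hv LT; rewrite (mu_pair_list vS un nsE hv) ?LT ?inE // /outer.
by congr (_ / _); apply: eq_bigl => j; rewrite inE.
Qed.

Lemma mu_triple_list S L v a b c i : v \in S -> uniq [:: a; b; c] ->
  [:: a; b; c] =i nbr e S v -> valid e S L -> i \in L v ->
  let t j := (1 - mu (S :\ v) L a j) * (1 - mu (S :\ v) (remove_on [:: a] j L) b j)
    * (1 - mu (S :\ v) (remove_on [:: a; b] j L) c j) in
  mu S L v i = t i / \sum_(j in L v) t j.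
Proof.
move=> vS un nsE hv iL t; rewrite (mu_prod _ _ _ vS un nsE hv) //.
have gE j : gprod e R S L v [:: a; b; c] j = t j.
  by rewrite /gprod !big_ord_recl big_ord0 mulr1 mulrA.
by rewrite gE; under eq_bigr do rewrite gE.
Qed.

(** One layer yields the bound [1/2] for at most one neighbour; for two neighbours both layers are
    needed. The lower bound keeps the starting error finite in the metric given by [Phi]. *)
Lemma mu_range S L v i : good S L v -> 0 <= mu S L v i <= 1/2 /\ (i \in L v -> 1/16 <= mu S L v i).
Proof.
have [n] := ubnP #|S|; elim: n S L v i => // n IHn S L v i; rewrite ltnS => leSn gd.
have [vS hv hL] := gd.
have un := enum_uniq (nbr e S v); set ns := enum _ in un.
have nsE : ns =i nbr e S v by move=> w; rewrite mem_enum.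
have hs := good_size un nsE gd.
have IH k j : 0 <= @children S L v ns k j <= 1/2.
  apply: (IHn _ _ _ _ _ (good_child j vS hv un nsE (ltn_ord k))).1.
  by move: leSn; rewrite (cardsD1 v S) vS.
have hx k (w : 'I_4) : w \in L v -> 0 <= @children S L v ns k w <= 1/2 by move=> _; exact: IH.
rewrite (mu_inner _ vS un nsE hv); split; last exact: inner_lower.
rewrite (inner_ge0 hs hx) /=.
have [le1|lt1] := leqP (size ns) 1; first exact: inner_le_half.
have s2 : size ns = 2%N by apply/eqP; rewrite eqn_leq lt1 (inner_arity hs).
rewrite -mu_inner //.
move: un nsE IH s2 hs; clear hx; case: ns lt1 => [|a [|b []]] // _ un nsE IH _ hs.
have LT : L v = setT by exact: full_colors.
rewrite (mu_pair _ vS un nsE hv LT).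
have gd_a : good (S :\ v) L a := @good_child S L v [:: a; b] i 0 vS hv un nsE isT.
have f_ge0 j : 0 <= mu (S :\ v) L a j by have /andP[] := IH ord0 j.
have f_le j : mu (S :\ v) L a j <= 1/2 by have /andP[] := IH ord0 j.
have hy j : 0 <= mu (S :\ v) (remove_on [:: a] j L) b j <= 1/2 by exact: (IH ord_max j).
have [j1 [j2 [j3 sum4]]] := four_colors i.
have fE : \sum_j mu (S :\ v) L a j = 1 by apply: mu_sum => //; case: gd_a.
rewrite sum4 in fE.
(* By induction the exact law of [a] is at most [1/2] whatever its degree, which is the first
   alternative. *)
have reg : regime (psimax R) (mu (S :\ v) L a i) (mu (S :\ v) L a j1) (mu (S :\ v) L a j2)
    (mu (S :\ v) L a j3) by left.
have [Z_gt0 _ a_le] := two_layer_bounds reg (f_ge0 i) (f_ge0 j1) (f_ge0 j2) (f_ge0 j3) fE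
  (hy i) (hy j1) (hy j2) (hy j3).
by rewrite /outer sum4 ler_pdivrMr //; apply: le_trans a_le _; rewrite mulrC div1r.
Qed.

End Good.

(** * Lipschitz bounds for the step at the root *)

Section Lipschitz.
Variable R : realFieldType.

Lemma mul_lipschitz (a a' b b' r s : R) : 0 <= a <= 1 -> 0 <= b' <= 1 ->
  `|a - a'| <= r -> `|b - b'| <= s -> `|a * b - a' * b'| <= r + s.
Proof.
move=> /andP[a0 a1] /andP[b0 b1] hr hs.
have -> : a * b - a' * b' = b' * (a - a') + a * (b - b') by ring.
have r0 : 0 <= r by apply: le_trans hr.
have s0 : 0 <= s by apply: le_trans hs.
by apply: le_trans (normrD_le (normrM_le b0 hr) (normrM_le a0 hs)) _; rewrite lerD // ler_piMl.
Qed.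

Lemma prod_lipschitz n (a a' : 'I_n -> R) r :
  (forall k, 0 <= a k <= 1) -> (forall k, 0 <= a' k <= 1) -> (forall k, `|a k - a' k| <= r) ->
  `|\prod_(k < n) a k - \prod_(k < n) a' k| <= n%:R * r.
Proof.
elim: n a a' => [|n IHn] a a' ha ha' hr; first by rewrite !big_ord0 subrr normr0 mul0r.
rewrite !big_ord_recr /= -natr1 mulrDl mul1r; apply: mul_lipschitz => //; last exact: IHn.
by rewrite prodr_ge0 ?prodr_ile1 // => k _; case/andP: (ha (widen_ord (leqnSn n) k)).
Qed.

(** The numerator contributes [r] and the sum over at most four colors [4 * r], both divided by a
    sum that is at least [lo]. *)
Lemma ratio_lipschitz (A : {set 'I_4}) (a a' : 'I_4 -> R) lo r i : i \in A -> 0 < lo ->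
  (forall j, j \in A -> lo <= a j) -> (forall j, j \in A -> lo <= a' j) ->
  (forall j, j \in A -> `|a j - a' j| <= r) ->
  `|a i / (\sum_(j in A) a j) - a' i / (\sum_(j in A) a' j)| <= 5 * r / lo.
Proof.
move=> iA lo0 ha ha' hr; set Z := \sum_(j in A) a j; set Z' := \sum_(j in A) a' j.
have sum_ge (b : 'I_4 -> R) : (forall j, j \in A -> lo <= b j) -> b i <= \sum_(j in A) b j.
  move=> hb; rewrite (big_setD1 i iA) /= lerDl sumr_ge0 // => j /setD1P[_ /hb].
  by apply: le_trans; exact: ltW.
have Z_ge : lo <= Z by apply: le_trans (ha i iA) (sum_ge _ ha).
have a'_le : a' i <= Z' := sum_ge _ ha'.
have Z'_gt0 : 0 < Z' by apply: lt_le_trans a'_le; apply: lt_le_trans (ha' i iA).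
have Z_gt0 : 0 < Z by apply: lt_le_trans Z_ge.
have r0 : 0 <= r by apply: le_trans (hr i iA).
have dZ : `|Z - Z'| <= 4 * r.
  rewrite /Z /Z' -sumrB; apply: le_trans (ler_norm_sum _ _ _) _.
  apply: (@le_trans _ _ (\sum_(j in A) r)); first by apply: ler_sum => j jA; exact: hr.
  by rewrite sumr_const -[r *+ _]mulr_natl ler_wpM2r // ler_nat card_colors.
have -> : a i / Z - a' i / Z' = ((a i - a' i) - a' i / Z' * (Z - Z')) / Z.
  by field; rewrite !gt_eqF.
have q0 : 0 <= a' i / Z' by rewrite divr_ge0 ?ltW // (lt_le_trans lo0) // ha'.
have q1 : a' i / Z' <= 1 by rewrite ler_pdivrMr // mul1r.
rewrite normrM normfV (gtr0_norm Z_gt0).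
apply: (@le_trans _ _ (5 * r / Z)); last by rewrite ler_wpM2l ?mulr_ge0 // lef_pV2.
rewrite ler_wpM2r ?invr_ge0 ?(ltW Z_gt0) //.
apply: le_trans (normrB_le (hr i iA) (normrM_le q0 dZ)) _.
have -> : 5 * r = r + 4 * r by ring.
by rewrite lerD2l ler_piMl // mulr_ge0.
Qed.

Lemma inner_lipschitz n (L1 : {set 'I_4}) (x x' : 'I_n -> 'I_4 -> R) r w :
  (n + 2 <= #|L1|)%N -> 0 <= r ->
  (forall k w, w \in L1 -> 0 <= x k w <= 1/2) -> (forall k w, w \in L1 -> 0 <= x' k w <= 1/2) ->
  (forall k w, w \in L1 -> `|x k w - x' k w| <= r) ->
  `|inner L1 x w - inner L1 x' w| <= 40 * r.
Proof.
move=> hL r0 hx hx' hr; rewrite /inner; case: ifP => wL; last by rewrite subrr normr0 mulr_ge0.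
have n2 := inner_arity hL.
have lo (z : 'I_n -> 'I_4 -> R) : (forall k w, w \in L1 -> 0 <= z k w <= 1/2) ->
    forall w, w \in L1 -> 1/4 <= inner_prod z w.
  move=> hz w' wL'; have /andP[h _] := inner_prod_bounds hz wL'; apply: le_trans h.
  by move: n2; clear; case: n => [|[|[|//]]] _; rewrite ?expr0 ?expr1 ?expr2; lra.
have -> : 40 * r = 5 * (2 * r) / (1/4) by field.
apply: (ratio_lipschitz wL) => [||| j jL]; [by rewrite divr_gt0|exact: lo|exact: lo|].
apply: (@le_trans _ _ (n%:R * r)); last by rewrite ler_wpM2r // ler_nat.
have c01 (z : R) : 0 <= z <= 1/2 -> 0 <= 1 - z <= 1.
  by move=> hz; rewrite half_compl_ge0 //; case/andP: (half_compl hz).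
apply: prod_lipschitz => k; rewrite ?c01 ?hx ?hx' //.
have -> : 1 - x k j - (1 - x' k j) = x' k j - x k j by ring.
by rewrite distrC hr.
Qed.

Lemma inner_upper n (L1 : {set 'I_4}) (x : 'I_n -> 'I_4 -> R) w :
  (n + 2 <= #|L1|)%N -> (forall k w, w \in L1 -> 0 <= x k w <= 1/2) -> inner L1 x w <= 4/7.
Proof.
move=> hL hx; have [n1|n2] := leqP n 1.
  by apply: le_trans (inner_le_half hL hx w n1) _; lra.
have /andP[] // : 1/13 <= inner L1 x w <= 4/7.
by apply: inner_bounds => //; apply/eqP; rewrite eqn_leq n2 (inner_arity hL).
Qed.

End Lipschitz.

(** * Closeness along paths *)

From mathcomp Require Import boolp reals normedtype derive Rstruct.
Import numFieldNormedType.Exports.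

Section Derivatives.
Variable R : realType.
Implicit Types (f g : R -> R) (t a b c : R).

Definition der f t a : Prop := is_derive t (1 : R) f a.

Lemma der_cst c t : der (fun=> c) t 0.
Proof. exact: is_derive_cst. Qed.

Lemma derD f g t a b : der f t a -> der g t b -> der (fun s => f s + g s) t (a + b).
Proof. exact: is_deriveD. Qed.

Lemma derN f t a : der f t a -> der (fun s => - f s) t (- a).
Proof. exact: is_deriveN. Qed.

Lemma derB f g t a b : der f t a -> der g t b -> der (fun s => f s - g s) t (a - b).
Proof. by move=> fa gb; apply: derD => //; apply: derN. Qed.

Lemma derM f g t a b :
  der f t a -> der g t b -> der (fun s => f s * g s) t (a * g t + f t * b).
Proof.
move=> fa gb; apply: (is_derive_eq (is_deriveM fa gb)).
by rewrite addrC [a * _]mulrC.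
Qed.

Lemma der_div f g t a b : g t != 0 -> der f t a -> der g t b ->
  der (fun s => f s / g s) t ((a * g t - f t * b) / g t ^+ 2).
Proof.
move=> g0 fa gb.
have gV : der (fun s => (g s)^-1) t (- g t ^- 2 * b).
  case: gb => gd <-; apply: (is_derive_eq (derivableP (derivableV g0 gd))).
  exact: deriveV.
by apply: (is_derive_eq (derM fa gV)); field.
Qed.

Lemma der_sum (I : Type) (r : seq I) (P : pred I) (h : I -> R -> R) (d : I -> R) t :
  (forall i, P i -> der (h i) t (d i)) ->
  der (fun s => \sum_(i <- r | P i) h i s) t (\sum_(i <- r | P i) d i).
Proof.
move=> hd; elim: r => [|i r IHr].
  by under eq_fun do rewrite big_nil; rewrite big_nil; apply: der_cst.
under eq_fun do rewrite big_cons; rewrite big_cons.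
by case: ifP => // Pi; apply: derD => //; apply: hd.
Qed.

Lemma der_logprod n (h : 'I_n -> R -> R) (q : 'I_n -> R) t :
  (forall k, der (h k) t (h k t * q k)) ->
  der (fun s => \prod_(k < n) h k s) t (\prod_(k < n) h k t * \sum_(k < n) q k).
Proof.
elim: n h q => [|n IHn] h q hq.
  by under eq_fun do rewrite big_ord0; rewrite !big_ord0 mulr0; apply: der_cst.
under eq_fun do rewrite big_ord_recr /=.
rewrite !big_ord_recr /=.
have := derM (IHn (fun k => h (widen_ord (leqnSn n) k)) (fun k => q (widen_ord (leqnSn n) k)) _) (hq ord_max).
move=> H; apply: (is_derive_eq (H _)); first by move=> k; apply: hq.
ring.
Qed.

Lemma der_le_dist f M : (forall t, 0 <= t <= 1 -> exists2 d, der f t d & `|d| <= M) ->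
  `|f 1 - f 0| <= M.
Proof.
move=> H.
have dE t : 0 <= t <= 1 -> derivable f t 1 /\ `|'D_1 f t| <= M.
  by move=> /H [d dd dM]; split; [case: dd|have -> : 'D_1 f t = d by case: dd].
have [||c c01 ->] := @MVT_segment R f (fun t => 'D_1 f t) 0 1 ler01.
- move=> x; rewrite in_itv /= => /andP[x0 x1].
  by apply: derivableP; case: (dE x) => //; rewrite !ltW.
- apply: derivable_within_continuous => x; rewrite in_itv /= => x01.
  by case: (dE x).
rewrite subr0 mulr1; move: c01; rewrite in_itv /= => /dE[]//.
Qed.

End Derivatives.

Section Close.
Variable R : realType.
Implicit Types (eps x y t : R) (X : R -> R).

(* [slow eps X] says that [X] moves at speed at most [eps] in the metric [|dx| / Phi x]. *)
Definition slow eps X : Prop := forall t, 0 <= t <= 1 ->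
  0 <= X t <= 1/2 /\ exists2 d, der X t d & `|d| <= eps * Phi (X t).

Definition close eps x y : Prop := exists2 X, X 0 = x /\ X 1 = y & slow eps X.

Lemma close_range eps x y : close eps x y -> 0 <= x <= 1/2.
Proof. by move=> [X [<- _] /(_ 0)]; rewrite lexx ler01 => -[]. Qed.

Lemma close_refl eps x : 0 <= eps -> 0 <= x <= 1/2 -> close eps x x.
Proof.
move=> e0 hx; exists (fun=> x) => // t _; split=> //.
by exists 0; [exact: der_cst|rewrite normr0 mulr_ge0 ?Phi_ge0].
Qed.

(** The segment has length at most [7/16], and [Phi] is at least [7/2000] on [1/16, 1/2]. *)
Lemma close_line x y : 1/16 <= x <= 1/2 -> 1/16 <= y <= 1/2 -> close 200 x y.
Proof.
move=> /andP[x0 x1] /andP[y0 y1]; exists (fun t => x + t * (y - x)).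
  by rewrite mul0r addr0 mul1r; split => //; ring.
move=> t /andP[t0 t1]; have [h1 h2] : 1/16 <= x + t * (y - x) /\ x + t * (y - x) <= 1/2 by split; nra.
split; first by apply/andP; split => //; lra.
exists (0 + (1 * (y - x) + t * 0)).
  apply: derD; first exact: der_cst.
  by apply: (derM (f := id)); [exact: is_derive_id|exact: der_cst].
rewrite ler_norml; move: h1 h2; set z := x + _ => h1 h2; rewrite /Phi /kap; apply/andP; split; nra.
Qed.

Lemma close_dist eps x y : 0 <= eps -> close eps x y -> `|x - y| <= eps.
Proof.
move=> e0 [X [<- <-] sX]; rewrite distrC; apply: der_le_dist => t /sX[_ [d dd hd]].
exists d => //; apply: le_trans hd _; rewrite -[leRHS]mulr1 ler_wpM2l //; exact: Phi_le.
Qed.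

Lemma close_one_layer eps x x' y y' : 0 <= eps -> close eps x x' -> close eps y y' ->
  close (rate R * eps) ((1 - x) / (2 + y)) ((1 - x') / (2 + y')).
Proof.
move=> e0 [X [<- <-] sX] [Y [<- <-] sY].
exists (fun t => (1 - X t) / (2 + Y t)) => // t /[dup] /sX[hx [dx ddx hdx]] /sY[hy [dy ddy hdy]].
have [x0 x1] := andP hx; have [y0 y1] := andP hy.
have y2 : 0 < 2 + Y t by lra.
split.
  rewrite divr_ge0 ?(ltW y2) ?half_compl_ge0// ler_pdivrMr //; lra.
exists (((0 - dx) * (2 + Y t) - (1 - X t) * (0 + dy)) / (2 + Y t) ^+ 2).
  by apply: der_div; [rewrite gt_eqF|apply: derB => //; exact: der_cst|apply: derD => //; exact: der_cst].
exact: one_layer_contraction.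
Qed.

Lemma close_third eps x x' : 0 <= eps -> close eps x x' ->
  close (rate R * eps) ((1 - x) / 3) ((1 - x') / 3).
Proof.
move=> e0 [X [<- <-] sX].
exists (fun t => (1 - X t) / 3) => // t /sX[hx [dx ddx hdx]].
have [x0 x1] := andP hx.
split; first by apply/andP; split; lra.
exists ((0 - dx) / 3); last exact: third_contraction.
have := derM (derB (der_cst 1 t) ddx) (der_cst 3^-1 t).
by rewrite mulr0 addr0.
Qed.

End Close.

Section CloseTwoLayer.
Variable R : realType.

Lemma eq_inner n (L1 : {set 'I_4}) (x x' : 'I_n -> 'I_4 -> R) :
  (forall k w, w \in L1 -> x k w = x' k w) -> inner L1 x =1 inner L1 x'.
Proof.
move=> eqx w; have eqg w' : w' \in L1 -> inner_prod x w' = inner_prod x' w'.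
  by move=> wL; apply: eq_bigr => k _; rewrite eqx.
by rewrite /inner; case: ifP => // wL; rewrite eqg // (eq_bigr _ eqg).
Qed.

Lemma eq_outer (f f' y y' : 'I_4 -> R) : f =1 f' -> y =1 y' -> outer f y =1 outer f' y'.
Proof.
by move=> eqf eqy i; rewrite /outer eqf eqy; under eq_bigr do rewrite eqf eqy.
Qed.

(** The image of the given paths under the recursion is the required path; its speed is bounded at
    each time by [two_layer_contraction]. *)
Lemma close_two_layer n (L1 : {set 'I_4}) (x x' : 'I_n -> 'I_4 -> R) (y y' : 'I_4 -> R)
    (i : 'I_4) (eps : R) : 0 <= eps -> (n + 2 <= #|L1|)%N ->
  (forall k w, w \in L1 -> close eps (x k w) (x' k w)) ->
  (forall j, close eps (y j) (y' j)) ->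
  close (rate R * eps) (outer (inner L1 x) y i) (outer (inner L1 x') y' i).
Proof.
move=> e0 hL cx cy.
(* One path is chosen per entry; entries whose color is outside [L1] get the constant path 0. *)
have [X HX] : {X : 'I_n * 'I_4 -> R -> R & forall kw, kw.2 \in L1 ->
    (X kw 0 = x kw.1 kw.2 /\ X kw 1 = x' kw.1 kw.2) /\ slow eps (X kw)}.
  apply: (@choice _ _ (fun kw (Z : R -> R) => kw.2 \in L1 ->
    (Z 0 = x kw.1 kw.2 /\ Z 1 = x' kw.1 kw.2) /\ slow eps Z)) => -[k w] /=.
  by have [/(cx k)[Z HZ sZ]|] := boolP (w \in L1); [exists Z|exists (fun=> 0)].
have [Y HY] : {Y : 'I_4 -> R -> R & forall j,
    (Y j 0 = y j /\ Y j 1 = y' j) /\ slow eps (Y j)}.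
  apply: (@choice _ _ (fun j (Z : R -> R) => (Z 0 = y j /\ Z 1 = y' j) /\ slow eps Z)) => j.
  by have [Z HZ sZ] := cy j; exists Z.
exists (fun t => outer (inner L1 (fun k w => X (k, w) t)) (fun j => Y j t) i).
  split; apply: eq_outer.
  - by apply: eq_inner => k w wL; have [[]] := HX (k, w) wL.
  - by move=> j; have [[]] := HY j.
  - by apply: eq_inner => k w wL; have [[]] := HX (k, w) wL.
  - by move=> j; have [[]] := HY j.
move=> t t01.
pose xt k w := X (k, w) t; pose yt j := Y j t; pose f := inner L1 xt.
have hx k w : w \in L1 -> 0 <= xt k w <= 1/2.
  by move=> wL; have [_ /(_ t t01)[]] := HX (k, w) wL.
have hy j : 0 <= yt j <= 1/2 by have [_ /(_ t t01)[]] := HY j.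
have [dx Hdx] : {dx : 'I_n * 'I_4 -> R & forall kw, kw.2 \in L1 ->
    der (X kw) t (dx kw) /\ `|dx kw| <= eps * Phi (X kw t)}.
  apply: (@choice _ _ (fun kw d => kw.2 \in L1 ->
    der (X kw) t d /\ `|d| <= eps * Phi (X kw t))) => -[k w] /=.
  have [wL|] := boolP (w \in L1); last by exists 0.
  by have [_ /(_ t t01)[_ [d]]] := HX (k, w) wL; exists d.
have [dy Hdy] : {dy : 'I_4 -> R & forall j,
    der (Y j) t (dy j) /\ `|dy j| <= eps * Phi (yt j)}.
  apply: (@choice _ _ (fun j d => der (Y j) t d /\ `|d| <= eps * Phi (yt j))) => j.
  by have [_ /(_ t t01)[_ [d]]] := HY j; exists d.
(* Logarithmic derivatives of the inner products, set to 0 outside [L1], where [f] vanishes. *)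
pose q w := if w \in L1 then \sum_(k < n) - (dx (k, w) / (1 - xt k w)) else 0.
pose qm := \sum_w f w * q w.
have compl_gt0 z : 0 <= z <= 1/2 -> 0 < 1 - z :> R.
  by move=> /half_compl/andP[h _]; apply: lt_le_trans h; rewrite divr_gt0.
have hq w : `|q w| <= inner_rate R n * eps.
  rewrite /q; case: ifP => [wL|_]; last first.
    by rewrite normr0; apply: mulr_ge0 => //; exact: inner_rate_ge0.
  apply: le_trans (ler_norm_sum _ _ _) _.
  apply: (@le_trans _ _ (\sum_(k < n) psimax R * eps)); last first.
    by rewrite sumr_const card_ord -mulrnAl -[psimax R *+ n]mulr_natl ler_wpM2r // (inner_rate_ge _ hL).
  apply: ler_sum => k _; have [_ hd] := Hdx (k, w) wL.
  rewrite normrN normrM normfV (gtr0_norm (compl_gt0 _ (hx k w wL))).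
  apply: (@le_trans _ _ (eps * Phi (xt k w) / (1 - xt k w))).
    by rewrite ler_wpM2r // invr_ge0 ltW // compl_gt0 // hx.
  by rewrite -mulrA mulrC ler_wpM2r // Phi_compl_le // hx.
have dg w : w \in L1 ->
    der (fun s => inner_prod (fun k w => X (k, w) s) w) t (inner_prod xt w * q w).
  move=> wL; rewrite /q wL.
  apply: (@der_logprod R n (fun k s => 1 - X (k, w) s) (fun k => - (dx (k, w) / (1 - xt k w)))) => k.
  have [dd _] := Hdx (k, w) wL.
  apply: (is_derive_eq (derB (der_cst 1 t) dd)).
  by rewrite -/(xt k w); field; rewrite gt_eqF // compl_gt0 // hx.
have G_gt0 := inner_sum_gt0 hL hx.
(* The derivative of a normalised weight involves its logarithmic derivative minus the mean one. *)
have df w : der (fun s => inner L1 (fun k w => X (k, w) s) w) t (f w * (q w - qm)).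
  rewrite /f /inner; case: ifP => wL; last by rewrite mul0r; exact: der_cst.
  have dG := @der_sum R _ (index_enum _) (mem L1) _ _ t dg.
  have G_neq0 : \sum_(w in L1) inner_prod xt w != 0 by rewrite gt_eqF.
  apply: (is_derive_eq (der_div G_neq0 (dg w wL) dG)).
  have -> : qm = (\sum_(w in L1) inner_prod xt w * q w) / (\sum_(w in L1) inner_prod xt w).
    rewrite /qm (bigID (mem L1)) /= [X in _ + X]big1 ?addr0; last first.
      by move=> w' wL'; rewrite /f /inner (negbTE wL') mul0r.
    rewrite mulr_suml; apply: eq_bigr => w' wL'.
    by rewrite /f /inner wL' mulrAC.
  by field.
have f_ge0 w : 0 <= f w := inner_ge0 hL hx w.
have [j1 [j2 [j3 sum4]]] := four_colors i.
have fE : f i + f j1 + f j2 + f j3 = 1 by rewrite -sum4; exact: inner_sum1.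
have reg := inner_regime hL hx i j1 j2 j3.
have [] := two_layer_bounds reg (f_ge0 i) (f_ge0 j1) (f_ge0 j2) (f_ge0 j3) fE
  (hy i) (hy j1) (hy j2) (hy j3).
rewrite -(sum4 _ (fun j => (1 - f j) * (1 - yt j))) => Z_gt0 a_ge a_le.
split.
  rewrite /outer ler_pdivrMr // divr_ge0 ?(ltW Z_gt0) //=; last first.
    by apply: le_trans a_ge; rewrite divr_ge0.
  by apply: le_trans a_le _; rewrite mulrC div1r.
have da j : der (fun s => (1 - inner L1 (fun k w => X (k, w) s) j) * (1 - Y j s)) t
   (- (f j * (q j - qm)) * (1 - yt j) - (1 - f j) * dy j).
  have [ddy _] := Hdy j.
  apply: (is_derive_eq (derM (derB (der_cst 1 t) (df j)) (derB (der_cst 1 t) ddy))).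
  by rewrite -/(yt j) -/xt -/f; ring.
have dZ := @der_sum R _ (index_enum _) predT _ _ t (fun j _ => da j).
eexists.
  by apply: (der_div _ (da i) dZ); rewrite gt_eqF.
have /(_ e0) := two_layer_contraction _ reg (f_ge0 i) (f_ge0 j1) (f_ge0 j2) (f_ge0 j3) fE
  (hy i) (hy j1) (hy j2) (hy j3) (Hdy i).2 (Hdy j1).2 (Hdy j2).2 (Hdy j3).2 (hq i) (hq j1) (hq j2) (hq j3).
rewrite -(sum4 _ (fun j => f j * q j)) -/qm.
rewrite -(sum4 _ (fun j => (1 - f j) * (1 - yt j))).
rewrite -(sum4 _ (fun j => - (f j * (q j - qm)) * (1 - yt j) - (1 - f j) * dy j)).
exact.
Qed.

End CloseTwoLayer.

(** * The recursion *)

Section PCases.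
Variables (R : realFieldType) (T : finType) (nb : {set T} -> T -> seq T).
Implicit Types (S : {set T}) (L : T -> {set 'I_4}) (v : T) (i : 'I_4) (D : nat).
Local Notation P := (@P R T nb).

Lemma P_notin D S L v i : i \notin L v -> P D S L v i = 0.
Proof. by case: D => [|D] /= ->. Qed.

Lemma P_zero S L v i : i \in L v -> P 0 S L v i = inv_card R (L v).
Proof. by move=> /= ->. Qed.

Lemma P_isolated D S L v i : i \in L v -> nb S v = [::] -> P D S L v i = inv_card R (L v).
Proof. by case: D => [|D] /= -> // ->. Qed.

Definition inner_of D S L v v1 : 'I_4 -> R :=
  inner (L v1) (fun (k : 'I_(size (nb (S :\ v) v1))) w =>
    P D (S :\ v :\ v1) (remove_on (take k (nb (S :\ v) v1)) w L) (nth v (nb (S :\ v) v1) k) w).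

(** The disjunction leaves open which order the procedure chooses, so that one argument covers
    both. *)
Lemma P_two D S L v a b i : i \in L v -> nb S v = [:: a; b] ->
  exists v1 v2, (v1 = a /\ v2 = b \/ v1 = b /\ v2 = a) /\
  let f := inner_of D S L v v1 in
  let y j := P D (S :\ v) (remove_on [:: v1] j L) v2 j in
  P D.+1 S L v i = (1 - f i) * (1 - y i) / \sum_(j in L v) (1 - f j) * (1 - y j).
Proof.
move=> iL E; rewrite /= iL /= E.
set swap := (_ || _); exists (if swap then b else a), (if swap then a else b).
by split=> //; case: swap; [right|left].
Qed.

End PCases.

Section PClose.
Variables (R : realType) (T : finType) (e : rel T) (nb : {set T} -> T -> seq T).
Hypotheses (e_sym : symmetric e) (e_irr : irreflexive e) (hnb : nb_ok e nb).
Implicit Types (S : {set T}) (L : T -> {set 'I_4}) (v : T) (i : 'I_4) (D : nat).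
Local Notation P := (@P R T nb).
Local Notation mu := (@mu T e R).
Local Notation good := (@good T e).

(** [200] is the closeness at depth 0, from [close_line]. *)
Definition err D : R := 200 * rate R ^+ D.

Lemma err_ge0 D : 0 <= err D.
Proof.
apply: mulr_ge0; first exact: ler0n.
by apply: exprn_ge0; apply: divr_ge0; exact: ler0n.
Qed.

Lemma errS D : err D.+1 = rate R * err D.
Proof. by rewrite /err exprS; ring. Qed.

Lemma nb_uniq S v : uniq (nb S v).
Proof. by have [] := hnb S v. Qed.

Lemma nb_nbr S v : nb S v =i nbr e S v.
Proof. by move=> w; have [_ ->] := hnb S v; rewrite inE. Qed.

Lemma good_size_nb S L v : good S L v -> (size (nb S v) + 2 <= #|L v|)%N.
Proof. exact: (good_size (nb_uniq S v) (nb_nbr S v)). Qed.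

Lemma mu_isolated S L v i : v \in S -> valid e S L -> i \in L v -> nb S v = [::] ->
  mu S L v i = inv_card R (L v).
Proof.
move=> vS hv iL E; rewrite (mu_prod e_sym e_irr R vS (nb_uniq S v) (nb_nbr S v) hv iL) E.
have gE j : gprod e R S L v [::] j = 1 by rewrite /gprod big_ord0.
by rewrite gE; under eq_bigr do rewrite gE; rewrite sumr_const div1r.
Qed.

Lemma mu_single S L v v1 i : v \in S -> valid e S L -> i \in L v -> nb S v = [:: v1] ->
  mu S L v i = (1 - mu (S :\ v) L v1 i) / \sum_(j in L v) (1 - mu (S :\ v) L v1 j).
Proof.
move=> vS hv iL E; rewrite (mu_prod e_sym e_irr R vS (nb_uniq S v) (nb_nbr S v) hv iL) E.
have gE j : gprod e R S L v [:: v1] j = 1 - mu (S :\ v) L v1 j by rewrite /gprod big_ord1.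
by rewrite gE; under eq_bigr do rewrite gE.
Qed.

Lemma good_single S L v v1 : v \in S -> valid e S L -> nb S v = [:: v1] -> good (S :\ v) L v1.
Proof.
move=> vS hv E; have := @good_child T e e_sym e_irr S L v [:: v1] ord0 0 vS hv.
by rewrite -E => /(_ (nb_uniq S v) (nb_nbr S v)); rewrite E => /(_ isT).
Qed.

Definition close_at D := forall S L v i, good S L v -> close (err D) (P D S L v i) (mu S L v i).

Lemma P_close_single D S L v v1 i : close_at D -> good S L v -> i \in L v -> nb S v = [:: v1] ->
  close (err D.+1) (P D.+1 S L v i) (mu S L v i).
Proof.
move=> IH gd iL E; have [vS hv _] := gd; have := good_size_nb gd; rewrite E /= => hL.
have gd1 := good_single vS hv E.
have sum1 := mu_sum e_sym e_irr R v1 (let: And3 _ h _ := gd1 in h).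
rewrite (mu_single vS hv iL E) iL /= E errS.
have := card_colors (L v).
have [c2|_] := eqVneq #|L v| 2%N; first by rewrite c2 in hL.
have [c4 _|n4] := eqVneq #|L v| 4%N.
  have -> : \sum_(j in L v) (1 - mu (S :\ v) L v1 j) = 3.
    rewrite -(sub_sum_compl sum1); apply: eq_bigl => j.
    by rewrite (full_colors (A := L v)) ?inE ?c4.
  by apply: close_third; [exact: err_ge0|exact: IH].
rewrite leq_eqVlt (negbTE n4) /= ltnS => c3; have {hL n4}c3 : #|L v| = 3%N by apply/eqP; rewrite eqn_leq c3.
rewrite c3 /=; case: pickP => [j jL|noj] /=; last first.
  have : #|L v| = #|'I_4| by apply: eq_card => j; have /negbFE := noj j.
  by rewrite c3 card_ord.
rewrite (sum_compl_missing c3 jL sum1).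
by apply: close_one_layer; [exact: err_ge0|exact: IH|exact: IH].
Qed.

Lemma pair_layer S L v v1 v2 j : v \in S -> valid e S L -> uniq [:: v1; v2] ->
  [:: v1; v2] =i nbr e S v -> good (S :\ v) L v1 /\ good (S :\ v) (remove_on [:: v1] j L) v2.
Proof.
move=> vS hv un nsE; split.
  exact: (@good_child T e e_sym e_irr S L v [:: v1; v2] j 0 vS hv un nsE isT).
exact: (@good_child T e e_sym e_irr S L v [:: v1; v2] j 1 vS hv un nsE isT).
Qed.

Lemma inner_children_close D S L v v1 : close_at D -> good (S :\ v) L v1 ->
  forall (k : 'I_(size (nb (S :\ v) v1))) w,
  close (err D)
    (P D (S :\ v :\ v1) (remove_on (take k (nb (S :\ v) v1)) w L) (nth v (nb (S :\ v) v1) k) w)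
    (@children T e R (S :\ v) L v1 (nb (S :\ v) v1) k w).
Proof.
move=> IH [v1S hv _] k w; rewrite /children (set_nth_default v1) //; apply: IH.
by apply: good_child; rewrite ?nb_uniq // => u; rewrite nb_nbr.
Qed.

Lemma P_close_pair D S L v a b i : close_at D -> good S L v -> i \in L v -> nb S v = [:: a; b] ->
  close (err D.+1) (P D.+1 S L v i) (mu S L v i).
Proof.
move=> IH gd iL E; have [vS hv _] := gd; have := good_size_nb gd; rewrite E /= => hL.
have LT := full_colors hL.
have [v1 [v2 [v12 /= ->]]] := P_two R D iL E.
have [un nsE] : uniq [:: v1; v2] /\ [:: v1; v2] =i nbr e S v.
  have := nb_uniq S v; have := nb_nbr S v; rewrite E => nsE un.
  case: v12 => -[-> ->] //; split; first by move: un; rewrite /= !inE eq_sym.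
  by move=> w; rewrite -nsE !inE orbC.
rewrite (mu_pair e_sym e_irr R i vS un nsE hv LT) errS.
have [gd1 _] := pair_layer i vS hv un nsE; have [v1S hv1 _] := gd1.
have muE : mu (S :\ v) L v1 =1 inner (L v1) (@children T e R (S :\ v) L v1 (nb (S :\ v) v1)).
  by move=> w; apply: mu_inner => //; [exact: nb_uniq|exact: nb_nbr].
rewrite (eq_outer muE (fun=> erefl)).
have -> : \sum_(j in L v) (1 - inner_of R nb D S L v v1 j) *
      (1 - P D (S :\ v) (remove_on [:: v1] j L) v2 j) =
    \sum_j (1 - inner_of R nb D S L v v1 j) * (1 - P D (S :\ v) (remove_on [:: v1] j L) v2 j).
  by apply: eq_bigl => j; rewrite LT inE.
rewrite -/(outer (inner_of R nb D S L v v1) (fun j => P D (S :\ v) (remove_on [:: v1] j L) v2 j) i).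
apply: close_two_layer.
- exact: err_ge0.
- exact: good_size_nb gd1.
- by move=> k w _; apply: inner_children_close.
- by move=> j; apply: IH; have [] := pair_layer j vS hv un nsE.
Qed.

(** At depth 0 both values lie in [1/16, 1/2], since lists have 2 to 4 colors. The step follows the
    degree of [v]; two spare colors among four exclude degree 3. *)
Lemma P_close D : close_at D.
Proof.
elim: D => [|D IH] S L v i gd; have [vS hv _] := gd; have [rng low] := mu_range e_sym e_irr R i gd.
  have [iL|iL] := boolP (i \in L v); last first.
    by rewrite P_notin // mu_notin //; apply: close_refl; [exact: err_ge0|rewrite lexx; apply: divr_ge0; rewrite ?ler01 ?ler0n].
  rewrite P_zero // /err expr0 mulr1; apply: close_line; last by rewrite low //; case/andP: rng.
  have := good_size_nb gd; have := card_colors (L v); rewrite /inv_card => c4 c2.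
  have {}c2 : (2 <= #|L v|)%N by apply: leq_trans c2; rewrite leq_addl.
  have h4 : #|L v|%:R <= 4 :> R by rewrite ler_nat.
  have h2 : 2 <= #|L v|%:R :> R by rewrite ler_nat.
  have h0 : 0 < #|L v|%:R :> R by apply: lt_le_trans h2.
  by rewrite -[X in _ <= X <= _]mul1r ler_pdivlMr // ler_pdivrMr //; apply/andP; split; lra.
have [iL|iL] := boolP (i \in L v); last first.
  by rewrite P_notin // mu_notin //; apply: close_refl; [exact: err_ge0|rewrite lexx; apply: divr_ge0; rewrite ?ler01 ?ler0n].
case E : (nb S v) => [|a [|b [|c s]]].
- by rewrite P_isolated // -(mu_isolated vS hv iL E); apply: close_refl; rewrite ?err_ge0.
- exact: P_close_single E.
- exact: P_close_pair E.
- have := leq_trans (good_size_nb gd) (card_colors (L v)); by rewrite E /= addn2.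
Qed.

End PClose.

(** * The error at the root *)

Section Root.
Variables (R : realType) (T : finType) (e : rel T) (nb : {set T} -> T -> seq T).
Hypotheses (e_sym : symmetric e) (e_irr : irreflexive e) (hnb : nb_ok e nb).
Implicit Types (S : {set T}) (L : T -> {set 'I_4}) (v : T) (i : 'I_4) (D : nat).
Local Notation P := (@P R T nb).
Local Notation mu := (@mu T e R).
Local Notation good := (@good T e).
Local Notation err := (err R).

Lemma P_dist D S L v i : good S L v -> `|P D S L v i - mu S L v i| <= err D.
Proof. by move=> gd; apply: close_dist; [exact: err_ge0|exact: P_close]. Qed.

Lemma P_rng D S L v i : good S L v -> 0 <= P D S L v i <= 1/2.
Proof. by move=> gd; exact: close_range (P_close R e_sym e_irr hnb D i gd). Qed.

Lemma mu_rng S L v i : good S L v -> 0 <= mu S L v i <= 1/2.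
Proof. by move=> gd; have [] := mu_range e_sym e_irr R i gd. Qed.

Lemma dist_compl (x y : R) : `|(1 - x) - (1 - y)| = `|x - y|.
Proof. by rewrite distrC; congr `|_|; ring. Qed.

Lemma compl01 (z : R) : 0 <= z <= 1/2 -> 0 <= 1 - z <= 1.
Proof. by move=> hz; rewrite half_compl_ge0 //; case/andP: (half_compl hz). Qed.

Lemma compl_half (z : R) : 0 <= z <= 1/2 -> 1/2 <= 1 - z.
Proof. by move=> /half_compl/andP[]. Qed.

Lemma root_single D S L v v1 i : v \in S -> valid e S L -> #|L v| = 2%N -> i \in L v ->
  nb S v = [:: v1] -> `|P D.+1 S L v i - mu S L v i| <= 1000 * err D.
Proof.
move=> vS hv L2 iL E; have gd := good_single e_sym e_irr hnb vS hv E.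
have -> : P D.+1 S L v i = (1 - P D (S :\ v) L v1 i) / \sum_(j in L v) (1 - P D (S :\ v) L v1 j).
  (* With two colors, [2 - x - y] is the sum of [1 - x] and [1 - y]. *)
  rewrite (sum_pair _ L2 iL) /= iL /= E L2 /=; congr (_ / _); ring.
rewrite (mu_single R e_sym e_irr hnb vS hv iL E).
have e0 := err_ge0 R D.
apply: le_trans (ratio_lipschitz (a := fun j => 1 - P D (S :\ v) L v1 j)
  (a' := fun j => 1 - mu (S :\ v) L v1 j) (lo := 1/2) (r := err D) iL _ _ _ _) _.
- by rewrite divr_gt0.
- by move=> j _; apply/compl_half/P_rng.
- by move=> j _; apply/compl_half/mu_rng.
- by move=> j _; rewrite dist_compl; exact: P_dist.
- by move: (err D) e0 => z z0; lra.
Qed.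

Lemma root_pair D S L v a b i : v \in S -> valid e S L -> i \in L v ->
  nb S v = [:: a; b] -> `|P D.+1 S L v i - mu S L v i| <= 1000 * err D.
Proof.
move=> vS hv iL E.
have [v1 [v2 [v12 /= ->]]] := P_two R D iL E.
have [un nsE] : uniq [:: v1; v2] /\ [:: v1; v2] =i nbr e S v.
  have := nb_uniq hnb S v; have := nb_nbr hnb S v; rewrite E => nsE un.
  case: v12 => -[-> ->] //; split; first by move: un; rewrite /= !inE eq_sym.
  by move=> w; rewrite -nsE !inE orbC.
rewrite (mu_pair_list e_sym e_irr R vS un nsE hv iL).
have [gd1 _] := pair_layer e_sym e_irr i vS hv un nsE; have [v1S hv1 _] := gd1.
have gd2 j := (pair_layer e_sym e_irr j vS hv un nsE).2.
have hL := good_size_nb hnb gd1.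
have muE w : mu (S :\ v) L v1 w = inner (L v1) (@children T e R (S :\ v) L v1 (nb (S :\ v) v1)) w.
  by apply: mu_inner => //; [exact: nb_uniq|exact: nb_nbr].
have cl := inner_children_close e_sym e_irr hnb (P_close R e_sym e_irr hnb D) gd1.
have hx (k : 'I_(size (nb (S :\ v) v1))) w : w \in L v1 ->
    0 <= P D (S :\ v :\ v1) (remove_on (take k (nb (S :\ v) v1)) w L)
      (nth v (nb (S :\ v) v1) k) w <= 1/2.
  by move=> _; exact: close_range (cl k w).
have hx' (k : 'I_(size (nb (S :\ v) v1))) w : w \in L v1 ->
    0 <= @children T e R (S :\ v) L v1 (nb (S :\ v) v1) k w <= 1/2.
  move=> _; apply: mu_rng; apply: good_child => //; [exact: nb_uniq|exact: nb_nbr].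
have e0 := err_ge0 R D.
(* The computed law of the first neighbour can reach [4/7], unlike the exact one, which stays below
   [1/2]. *)
have f_lo j : 3/7 <= 1 - inner_of R nb D S L v v1 j.
  have := inner_upper j hL hx; rewrite -/(inner_of R nb D S L v v1 j).
  by move: (inner_of _ _ _ _ _ _ _ _) => z; lra.
have f_hi j : 1 - inner_of R nb D S L v v1 j <= 1.
  by rewrite gerBl; exact: (inner_ge0 hL hx).
have f_lo' j : 3/7 <= 1 - mu (S :\ v) L v1 j.
  by have /andP[_] := mu_rng j gd1; move: (mu _ _ _ _) => z; lra.
have f_d j : `|inner_of R nb D S L v v1 j - mu (S :\ v) L v1 j| <= 40 * err D.
  rewrite muE; apply: inner_lipschitz => // k w wL.
  by apply: close_dist => //; exact: cl.
have lo (f y : R) : 3/7 <= 1 - f -> 0 <= y <= 1/2 -> 3/14 <= (1 - f) * (1 - y).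
  move=> hf /compl_half hy; have -> : 3/14 = 3/7 * (1/2) :> R by field.
  by rewrite ler_pM // divr_ge0.
apply: le_trans (ratio_lipschitz
  (a := fun j => (1 - inner_of R nb D S L v v1 j) * (1 - P D (S :\ v) (remove_on [:: v1] j L) v2 j))
  (a' := fun j => (1 - mu (S :\ v) L v1 j) * (1 - mu (S :\ v) (remove_on [:: v1] j L) v2 j))
  (lo := 3/14) (r := 40 * err D + err D) iL _ _ _ _) _.
- by rewrite divr_gt0.
- by move=> j _; apply: lo => //; exact: P_rng.
- by move=> j _; apply: lo => //; exact: mu_rng.
- move=> j _; apply: mul_lipschitz.
  + by rewrite f_hi andbT; apply: le_trans (f_lo j); rewrite divr_ge0.
  + exact: compl01 (mu_rng j (gd2 j)).
  + by rewrite dist_compl.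
  + by rewrite dist_compl; exact: P_dist.
(* The factor is [5 * 41 * 14 / 3], about 957; it determines the constant 1000. *)
- by move: (err D) e0 => z z0; lra.
Qed.

Lemma root_triple D S L v a b c i : v \in S -> valid e S L -> i \in L v ->
  nb S v = [:: a; b; c] -> `|P D.+1 S L v i - mu S L v i| <= 1000 * err D.
Proof.
move=> vS hv iL E.
have := nb_uniq hnb S v; have := nb_nbr hnb S v; rewrite E => nsE un.
rewrite (mu_triple_list e_sym e_irr R vS un nsE hv iL) /= iL /= E.
have ga j : good (S :\ v) L a := @good_child T e e_sym e_irr S L v _ j 0 vS hv un nsE isT.
have gb j : good (S :\ v) (remove_on [:: a] j L) b :=
  @good_child T e e_sym e_irr S L v _ j 1 vS hv un nsE isT.
have gc j : good (S :\ v) (remove_on [:: a; b] j L) c :=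
  @good_child T e e_sym e_irr S L v _ j 2 vS hv un nsE isT.
have e0 := err_ge0 R D.
have lo (x y z : R) : 0 <= x <= 1/2 -> 0 <= y <= 1/2 -> 0 <= z <= 1/2 ->
    1/8 <= (1 - x) * (1 - y) * (1 - z).
  move=> /compl_half hx /compl_half hy /compl_half hz.
  have -> : 1/8 = 1/2 * (1/2) * (1/2) :> R by field.
  have h2 : 0 <= 1/2 :> R by apply: divr_ge0; rewrite ?ler01 ?ler0n.
  by apply: ler_pM => //; [exact: mulr_ge0|exact: ler_pM].
apply: le_trans (ratio_lipschitz
  (a := fun j => (1 - P D (S :\ v) (remove_on [::] j L) a j)
          * (1 - P D (S :\ v) (remove_on [:: a] j L) b j)
          * (1 - P D (S :\ v) (remove_on [:: a; b] j L) c j))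
  (a' := fun j => (1 - mu (S :\ v) L a j) * (1 - mu (S :\ v) (remove_on [:: a] j L) b j)
          * (1 - mu (S :\ v) (remove_on [:: a; b] j L) c j))
  (lo := 1/8) (r := err D + err D + err D) iL _ _ _ _) _.
- by rewrite divr_gt0.
- by move=> j _; apply: lo; [exact: P_rng (ga j)|exact: P_rng|exact: P_rng].
- by move=> j _; apply: lo; [exact: mu_rng (ga j)|exact: mu_rng|exact: mu_rng].
- move=> j _.
  have /andP[pa0 pa1] := compl01 (P_rng D j (ga j)); have /andP[pb0 pb1] := compl01 (P_rng D j (gb j)).
  apply: mul_lipschitz.
  + by rewrite mulr_ge0 //= mulr_ile1.
  + exact: compl01 (mu_rng j (gc j)).
  + apply: mul_lipschitz; rewrite ?dist_compl.
    * exact: compl01 (P_rng D j (ga j)).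
    * exact: compl01 (mu_rng j (gb j)).
    * exact: P_dist (ga j).
    * exact: P_dist.
  + by rewrite dist_compl; exact: P_dist.
- by move: (err D) e0 => z z0; lra.
Qed.

(** If the root has two spare colors, [P_dist] applies. Otherwise its children still do, and one
    Lipschitz step costs a constant factor, only once. *)
Lemma root_dist D S L v i : v \in S -> valid e S L ->
  `|P D.+1 S L v i - mu S L v i| <= 1000 * err D.
Proof.
move=> vS hv; have e0 := err_ge0 R D.
have e1000 : 0 <= 1000 * err D by apply: mulr_ge0; [exact: ler0n|].
have [iL|iL] := boolP (i \in L v); last first.
  by rewrite P_notin // mu_notin // subrr normr0.
have := hv v vS; rewrite -(eq_card (nb_nbr hnb S v)) (card_uniqP (nb_uniq hnb S v)).
rewrite leq_eqVlt => /orP[/eqP L1|gt1]; last first.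
  have gd : good S L v.
    by split=> //; rewrite -(eq_card (nb_nbr hnb S v)) (card_uniqP (nb_uniq hnb S v)) addn2.
  apply: le_trans (P_dist D.+1 i gd) _; rewrite errS /rate.
  by move: (err D) e0 => z z0; lra.
have c4 := card_colors (L v); rewrite -L1 in c4.
case E : (nb S v) => [|a [|b [|c [|d s]]]].
- by rewrite P_isolated // (mu_isolated R e_sym e_irr hnb vS hv iL E) subrr normr0.
- by apply: (root_single D vS hv _ iL E); rewrite -L1 E.
- exact: root_pair E.
- exact: root_triple E.
- by rewrite E in c4.
Qed.

End Root.

(** * From the reals to ordered fields *)

Section Transfer.
Variables (R : realFieldType) (T : finType) (e : rel T) (nb : {set T} -> T -> seq T).
Implicit Types (S : {set T}) (L : T -> {set 'I_4}) (v : T) (i : 'I_4) (D : nat).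

Lemma ratr_inv_card (A : {set 'I_4}) : ratr (inv_card rat A) = inv_card R A.
Proof. by rewrite /inv_card fmorphV rmorph_nat. Qed.

(** The procedure uses only field operations and tests on finite data, so it commutes with the
    embedding of the rationals. *)
Lemma ratr_P D S L v i : ratr (@P rat T nb D S L v i) = @P R T nb D S L v i.
Proof.
elim: D S L v i => [|D IH] S L v i /=; case: ifP => _; rewrite ?rmorph0 ?ratr_inv_card //.
case: (nb S v) => [|a [|b [|c [|d s]]]]; rewrite ?ratr_inv_card //.
- do 3?case: ifP => _; rewrite ?ratr_inv_card // fmorph_div;
  by rewrite ?rmorphB ?rmorphD ?rmorph1 ?rmorph_nat /= !IH.
- set swap := (_ || _).
  set v1 := (if swap then b else a); set v2 := (if swap then a else b).
  have gE w : ratr (\prod_(k < size (nb (S :\ v) v1))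
      (1 - @P rat T nb D (S :\ v :\ v1) (remove_on (take k (nb (S :\ v) v1)) w L)
         (nth v (nb (S :\ v) v1) k) w)) =
      \prod_(k < size (nb (S :\ v) v1))
      (1 - @P R T nb D (S :\ v :\ v1) (remove_on (take k (nb (S :\ v) v1)) w L)
         (nth v (nb (S :\ v) v1) k) w).
    by rewrite rmorph_prod; apply: eq_bigr => k _; rewrite rmorphB rmorph1 /= IH.
  have tE j : ratr ((1 - (if j \in L v1 then
      \prod_(k < size (nb (S :\ v) v1))
      (1 - @P rat T nb D (S :\ v :\ v1) (remove_on (take k (nb (S :\ v) v1)) j L)
         (nth v (nb (S :\ v) v1) k) j) / \sum_(w in L v1) \prod_(k < size (nb (S :\ v) v1))
      (1 - @P rat T nb D (S :\ v :\ v1) (remove_on (take k (nb (S :\ v) v1)) w L)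
         (nth v (nb (S :\ v) v1) k) w) else 0)) * (1 - @P rat T nb D (S :\ v) (remove_on [:: v1] j L) v2 j)) =
      ((1 - (if j \in L v1 then
      \prod_(k < size (nb (S :\ v) v1))
      (1 - @P R T nb D (S :\ v :\ v1) (remove_on (take k (nb (S :\ v) v1)) j L)
         (nth v (nb (S :\ v) v1) k) j) / \sum_(w in L v1) \prod_(k < size (nb (S :\ v) v1))
      (1 - @P R T nb D (S :\ v :\ v1) (remove_on (take k (nb (S :\ v) v1)) w L)
         (nth v (nb (S :\ v) v1) k) w) else 0)) * (1 - @P R T nb D (S :\ v) (remove_on [:: v1] j L) v2 j)).
    rewrite rmorphM !rmorphB rmorph1 /= IH; congr ((_ - _) * _).
    case: ifP => _; last by rewrite rmorph0.
    by rewrite fmorph_div /= gE rmorph_sum /=; congr (_ / _); apply: eq_bigr.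
  by rewrite fmorph_div /= tE rmorph_sum /=; congr (_ / _); apply: eq_bigr.
- rewrite fmorph_div rmorph_sum; congr (_ / _); last apply: eq_bigr => j _;
  by rewrite !rmorphM !rmorphB rmorph1 /= !IH.
Qed.

Lemma ratr_Prob L v i : ratr (@Prob rat T e L v i) = @Prob R T e L v i.
Proof. by rewrite /Prob fmorph_div !rmorph_nat. Qed.

End Transfer.

Lemma Prob_mu (R : realFieldType) (T : finType) (e : rel T) (L : T -> {set 'I_4}) v i :
  @Prob R T e L v i = mu e R [set: T]%SET L v i.
Proof.
have E c : proper_col e L c = pcol e [set: T]%SET L c.
  rewrite /proper_col /pcol; congr (_ && _); apply: eq_forallb => u; rewrite inE //=.
  by apply: eq_forallb => w; rewrite inE.
by rewrite /Prob /mu; congr (_%:R / _%:R); apply: eq_card => c; rewrite !inE E.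
Qed.

Lemma rate_ge0 (R : realFieldType) : 0 <= rate R.
Proof. by apply: divr_ge0; exact: ler0n. Qed.

Lemma rate_le_lambda (R : realFieldType) : rate R <= lambda R.
Proof.
by rewrite /rate /lambda; lra.
Qed.

Lemma P_error_real (R : realType) (T : finType) (e : rel T) (nb : {set T} -> T -> seq T) :
  symmetric e -> irreflexive e -> nb_ok e nb ->
  forall L : T -> {set 'I_4}, (forall u : T, (deg e u + 1 <= #|L u|)%N) ->
  forall (v : T) (i : 'I_4) (D : nat), (3 <= D)%N ->
  `| @P R T nb D [set: T]%SET L v i - @Prob R T e L v i | <= 1000 * 200 * rate R ^+ (D - 3).
Proof.
move=> e_sym e_irr hnb L hL v i [//|D] D3.
have hv : valid e [set: T]%SET L.
  move=> u _; move: (hL u); rewrite addn1; congr (_ < _)%N.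
  by apply: eq_card => w; rewrite !inE.
rewrite Prob_mu; apply: le_trans (root_dist R e_sym e_irr hnb D i (finset.in_setT v) hv) _.
rewrite /err mulrA.
have r0 := rate_ge0 R.
have r1 : rate R <= 1 by rewrite /rate; lra.
apply: ler_wpM2l; first by apply: mulr_ge0; exact: ler0n.
(* Here [D] is one less than the original depth, so its exponent exceeds the required one by 2; this
   is harmless because [rate] is at most 1. *)
by apply: ler_wiXn2l => //; rewrite subSS leq_subr.
Qed.

Theorem theorem13 (R : realFieldType) :
  exists C : R, 0 < C /\
  forall (T : finType) (e : rel T) (nb : {set T} -> T -> seq T),
    symmetric e -> irreflexive e -> @nb_ok T e nb ->
    forall L : T -> {set 'I_4},
      (forall u : T, (deg e u + 1 <= #|L u|)%N) ->
      forall (v : T) (i : 'I_4) (D : nat), (3 <= D)%N ->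
        `| @P R T nb D [set: T] L v i - @Prob R T e L v i |
          <= C * lambda R ^+ (D - 3).
Proof.
(* The loss at the root times the closeness at depth 0. *)
exists (1000 * 200); split=> [|T e nb e_sym e_irr hnb L hL v i D D3]; first by apply: mulr_gt0; rewrite ltr0n.
(* The inequality over the reals is an image of one between rationals; it is pulled back to [rat]
   and then pushed forward to [R]. *)
have := P_error_real Rdefinitions.R e_sym e_irr hnb hL v i D3.
rewrite -ratr_P -ratr_Prob -rmorphB /= -ratr_norm.
have rateE (F : realFieldType) : ratr (rate rat) = rate F by rewrite /rate fmorph_div !rmorph_nat.
rewrite -rateE.
have CE (F : realFieldType) : 1000 * 200 = ratr (1000 * 200 : rat) :> F by rewrite rmorphM !rmorph_nat.
rewrite CE -rmorphXn -rmorphM /= ler_rat => H.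
apply: (@le_trans _ _ (1000 * 200 * rate R ^+ (D - 3))).
  by rewrite -ratr_P -ratr_Prob -rmorphB /= -ratr_norm CE -rateE -rmorphXn -rmorphM /= ler_rat.
have r0 := rate_ge0 R.
apply: ler_wpM2l; first by apply: mulr_ge0; exact: ler0n.
apply: lerXn2r; rewrite ?nnegrE; [exact: r0| |exact: rate_le_lambda].
exact: le_trans r0 (rate_le_lambda R).
Qed.
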